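(* Let $m,n\ge1$ and $\nu=(NE^m)^n$. Let $\mathcal D^{\mathrm{in}}_{n,m}$ be the set of $m$-Dyck paths of height $n$ whose in-degree in the $\nu$-Tamari poset is maximal, and let $\le_D$ be the restriction of the $\nu$-Tamari order to $\mathcal D^{\mathrm{in}}_{n,m}$. For $D\in\mathcal D^{\mathrm{in}}_{n,m}$ let $\widehat D$ be defined by $(\mathbf{LA}_{\widehat D})_i=(\mathbf{LA}_D)_i-\left|\{j\in[n]: h_j^D\text{ comes before } r_i^D\}\right|$. Then the map $\phi:(\mathcal D^{\mathrm{in}}_{n,m},\le_D)\to(\mathcal D_{n,m-1},\le_G)$ with $\mathbf{LA}_{\phi(D)}=\mathbf{LA}_{\widehat D}$ is a poset isomorphism, where $\le_G$ is the $(NE^{m-1})^n$-Greedy order.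
   Context: For $k\ge0$ and $\mu=(NE^k)^n$ (a path from $(0,0)$ to $(kn,n)$ with unit north steps $N$ and east steps $E$), a $k$-Dyck path of height $n$ is a lattice path from $(0,0)$ to $(kn,n)$ with $N$ and $E$ steps lying weakly above $\mu$; $\mathcal D_{n,k}$ is the set of them. For such $D$ and $i\in[n]$, $r_i^D$ is the point immediately before its $i$-th north step; the left area vector is $\mathbf{LA}_D=(x_1,\dots,x_n)$ with $x_i$ the $x$-coordinate of $r_i^D$ (a path is determined by it). For $p=(x,y)$ on $D$, $\mathrm{horiz}(p)=X(y)-x$ with $X(y)$ the largest $x$-coordinate of a point of $\mu$ at height $y$. The touch point $t_i^D$ is the first point of $D$ after $r_i^D$ with the same horizontal distance as $r_i^D$; the hit point $h_i^D$ is the first point of $D$ after $r_i^D$ with that horizontal distance which is either followed by an east step or is the final point. A point $(x,y)$ comes before $(a,b)$ if $x<a$. Tamari order: if $r_i^D$ is preceded by an east step, write $D=dEtf$ ($dE$ = subpath from $(0,0)$ to $r_i^D$, $t$ = subpath from $r_i^D$ to $t_i^D$, $f$ = the rest), set $D\uparrow_i=dtEf$; the $\mu$-Tamari order is the partial order whose cover relations are $D\lessdot D\uparrow_i$ whenever defined, and the in-degree of $D$ is the number of elements it covers. Greedy order: if $r_i^D$ is preceded by an east step and followed by a north step, write $D=dEhf$ ($dE$ = subpath from $(0,0)$ to $r_i^D$, $h$ = subpath from $r_i^D$ to $h_i^D$, $f$ = the rest) and set $D\uparrow^G_i=dhEf$; the $\mu$-Greedy order $\le_G$ is the partial order on $\mathcal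 D_{n,k}$ whose cover relations are $D\lessdot_G D\uparrow^G_i$ whenever defined. *)

(* Defs.v *)
From mathcomp Require Import all_boot all_order all_algebra.

Set Implicit Arguments.
Unset Strict Implicit.
Unset Printing Implicit Defensive.

(* A lattice path starting at (0,0) is the word of its unit steps.  A point of
   the path [w] is given by its position [p <= size w], i.e. the number of
   steps of [w] preceding it. *)
Definition stepN : bool := true.
Definition stepE : bool := false.

Definition xcoord (w : seq bool) (p : nat) : nat := count_mem stepE (take p w).
Definition ycoord (w : seq bool) (p : nat) : nat := count_mem stepN (take p w).

(* (N E^k)^n *)
Definition mu (n k : nat) : seq bool := flatten (nseq n (stepN :: nseq k stepE)).

Definition maxX (n k y : nat) : nat :=
  \max_(p < (size (mu n k)).+1 | ycoord (mu n k) p == y) xcoord (mu n k) p.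

Definition weakly_above (n k : nat) (w : seq bool) : bool :=
  [forall p : 'I_(size w).+1, xcoord w p <= maxX n k (ycoord w p)].

Definition is_dyck (n k : nat) (w : seq bool) : bool :=
  [&& count_mem stepN w == n, count_mem stepE w == k * n & weakly_above n k w].

(* The length in the tuple type is forced by [is_dyck]; it is there to make
   the type finite. *)
Definition dyck (n k : nat) : Type :=
  {w : (n + k * n).-tuple bool | is_dyck n k w}.

Definition word (n k : nat) (D : dyck n k) : seq bool := val (val D).

Section Points.
Variables (n k : nat) (D : dyck n k).
Let w := word D.

(* The subtraction never truncates: [D] lies weakly above [mu n k]. *)
Definition horiz (p : nat) : nat := maxX n k (ycoord w p) - xcoord w p.

(* Positions of the points r_i, t_i, h_i.  Indices are shifted by one:
   [i : 'I_n] stands for the index i + 1 of [n] = {1, ..., n}.  In these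
   three definitions the default value [size w] is never reached. *)
Definition rpos (i : 'I_n) : nat :=
  nth (size w) [seq p <- iota 0 (size w) | nth stepE w p == stepN] i.

Definition tpos (i : 'I_n) : nat :=
  head (size w) [seq p <- iota (rpos i).+1 (size w - rpos i)
                | horiz p == horiz (rpos i)].

Definition followed_by_E (p : nat) : bool := nth stepN w p == stepE.
Definition followed_by_N (p : nat) : bool := nth stepE w p == stepN.
Definition preceded_by_E (p : nat) : bool :=
  (0 < p) && (nth stepN w p.-1 == stepE).

Definition hpos (i : 'I_n) : nat :=
  head (size w) [seq p <- iota (rpos i).+1 (size w - rpos i)
                | (horiz p == horiz (rpos i)) &&
                  (followed_by_E p || (p == size w))].

Definition LA (i : 'I_n) : nat := xcoord w (rpos i).

(* "The point at position p comes before the point at position q" compares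
   x-coordinates, not positions along the path. *)
Definition comes_before (p q : nat) : bool := xcoord w p < xcoord w q.

(* If [w] = d E s f, where d E ends at position [a] and s at position [b],
   this is d s E f. *)
Definition slide (a b : nat) : seq bool :=
  take a.-1 w ++ drop a (take b w) ++ stepE :: drop b w.

(* Integer-valued, to avoid truncated subtraction. *)
Definition LAhat (i : 'I_n) : int :=
  ((LA i)%:Z -
   #|[set j : 'I_n | comes_before (hpos j) (rpos i)]|%:Z)%R.

End Points.

Definition tamari_step (n k : nat) (D D' : dyck n k) : bool :=
  [exists i : 'I_n, preceded_by_E D (rpos D i) &&
                    (word D' == slide D (rpos D i) (tpos D i))].

Definition greedy_step (n k : nat) (D D' : dyck n k) : bool :=
  [exists i : 'I_n, [&& preceded_by_E D (rpos D i),
                        followed_by_N D (rpos D i) &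
                        word D' == slide D (rpos D i) (hpos D i)]].

(* A finite partial order is the reflexive transitive closure of its cover
   relation. *)
Definition tamari_le (n k : nat) : rel (dyck n k) := connect (@tamari_step n k).
Definition greedy_le (n k : nat) : rel (dyck n k) := connect (@greedy_step n k).

Definition covered_by (T : finType) (le : rel T) (x y : T) : bool :=
  [&& x != y, le x y &
      [forall z, (le x z && le z y) ==> ((z == x) || (z == y))]].

Definition indegree (n k : nat) (D : dyck n k) : nat :=
  #|[set D' | covered_by (@tamari_le n k) D' D]|.

Definition dyck_in (n k : nat) : {set dyck n k} :=
  [set D | [forall D' : dyck n k, indegree D' <= indegree D]].

Definition poset_iso (S T : Type) (leS : rel S) (leT : rel T) (f : S -> T) : Prop :=
  bijective f /\ (forall x y, leS x y = leT (f x) (f y)).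

(* Main.v *)
Require Import Defs.
From mathcomp Require Import all_boot all_order all_algebra.
From mathcomp Require Import zify.

Set Implicit Arguments.
Unset Strict Implicit.
Unset Printing Implicit Defensive.

(** Encode a k-Dyck path by its height vector [a_i = horiz r_i] (with [a_n = 0]):
    a Tamari step adds 1 to the rows [i, ..., e - 1] where [e] is the first later row with
    [a_e <= a_i], a greedy step does the same with [a_e < a_i].  Every Tamari
    step is a cover, so the in-degree counts the [i] with [a_e < a_i], and it is maximal when
    this holds for all [i] except the first.  Call [j < i] an ancestor of [i] if
    [a_j < a_l] for [j < l <= i]; on paths of maximal in-degree [phi] subtracts from [a_i] its number of
    ancestors.  The result [b] has the same ancestors, now defined by
    [b_j <= b_l], so adding the number of these gives the inverse [psi].

    A greedy step of [b] at [i] raises [psi b] on the same rows by some [c > 0], which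
    amounts to [c] Tamari steps at [i].  Conversely, along the Tamari order the relations
    [forall l in (j, i], a_j + d <= a_l] with [d > 0] are preserved.  If they all pass
    from [psi b] to [psi b'] and [i] is the first row where [b] and [b'] differ, then
    [b_i < b'_i], the greedy step of [b] at [i] is possible, and after
    it the relations still pass to [psi b']; iterating reaches [b']. *)

(** * Coordinates of points on a word *)

Fixpoint north_xs (x : nat) (w : seq bool) : seq nat :=
  if w is s :: w' then
    if s then x :: north_xs x w' else north_xs x.+1 w'
  else [::].

Lemma size_north_xs x w : size (north_xs x w) = count_mem stepN w.
Proof. by elim: w x => [|[] w IH] x //=; rewrite IH. Qed.

Lemma north_xs_cat x u v :
  north_xs x (u ++ v) = north_xs x u ++ north_xs (x + count_mem stepE u) v.
Proof.
elim: u x => [|[] u IH] x /=; rewrite ?addn0 //.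
  by rewrite IH add0n.
by rewrite IH addnA addn1.
Qed.

Lemma north_xsS x w : north_xs x.+1 w = map S (north_xs x w).
Proof. by elim: w x => [|[] w IH] x //=; rewrite IH. Qed.

Lemma count_steps (w : seq bool) : count_mem stepE w + count_mem stepN w = size w.
Proof. by elim: w => [|[] w IH] //=; rewrite -IH ?addnS. Qed.

Lemma coord_sum w p : p <= size w -> xcoord w p + ycoord w p = p.
Proof. by move=> pw; rewrite count_steps size_takel. Qed.

Lemma ycoord_le w p : ycoord w p <= count_mem stepN w.
Proof. by rewrite -[w in leqRHS](cat_take_drop p) count_cat leq_addr. Qed.

(** The default value is the x-coordinate of the end of the word, so that bounds and monotonicity
    extend past the last north step. *)
Lemma north_xs_ge x w i : x <= nth (x + count_mem stepE w) (north_xs x w) i.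
Proof.
elim: w x i => [|[] w IH] x i /=.
- by rewrite nth_nil leq_addr.
- by case: i => [|i] //=; rewrite add0n.
- by have := IH x.+1 i; rewrite addSnnS => H; apply: leq_trans H.
Qed.

Lemma north_xs_nondecr x w i :
  nth (x + count_mem stepE w) (north_xs x w) i
  <= nth (x + count_mem stepE w) (north_xs x w) i.+1.
Proof.
elim: w x i => [|[] w IH] x i //=.
  by rewrite nth_default // nth_default.
  by rewrite add0n; case: i => [|i] /=; [exact: north_xs_ge | exact: IH].
by have := IH x.+1 i; rewrite addSnnS.
Qed.

(** East steps after the last north step leave no trace in [north_xs]; the size recovers their
    number. *)
Lemma north_xs_inj x w w' :
  size w = size w' -> north_xs x w = north_xs x w' -> w = w'.
Proof.
elim: w x w' => [|s w IH] x [|s' w'] //= [eq_sz].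
have lt_hd u : x :: north_xs x w <> north_xs x.+1 u /\ x :: north_xs x w' <> north_xs x.+1 u.
  have H : forall v, x :: v <> north_xs x.+1 u.
    move=> v H; have := north_xs_ge x.+1 u 0.
    by rewrite -H /= ltnn.
  by split; apply: H.
case: s; case: s' => //.
- by move=> [/(IH _ _ eq_sz) ->].
- by move/(proj1 (lt_hd _)).
- by move/esym/(proj2 (lt_hd _)).
- by move/(IH _ _ eq_sz) ->.
Qed.

Lemma coord_bounds x w p : p <= size w ->
  x + xcoord w p <= nth (x + count_mem stepE w) (north_xs x w) (ycoord w p) /\
  (0 < ycoord w p ->
   nth (x + count_mem stepE w) (north_xs x w) (ycoord w p).-1 <= x + xcoord w p).
Proof.
rewrite /xcoord /ycoord.
elim: w x p => [|[] w IH] x [|p] //= pw; rewrite ?take0 /= ?addn0 //.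
- have [IH1 IH2] := IH x p pw; rewrite ?add0n ?add1n /=; split=> // _.
  case E: (count_mem stepN _) IH2 => [|y] /= IH2; first exact: leq_addr.
  exact: IH2.
- by split=> //; have := north_xs_ge x.+1 w 0; rewrite addSnnS; apply: ltnW.
- have [IH1 IH2] := IH x.+1 p pw.
  by rewrite add0n !addnA !addn1; split.
Qed.

Definition north_x (w : seq bool) (i : nat) : nat :=
  nth (count_mem stepE w) (north_xs 0 w) i.

Lemma north_x_bounds w p : p <= size w ->
  xcoord w p <= north_x w (ycoord w p) /\
  (0 < ycoord w p -> north_x w (ycoord w p).-1 <= xcoord w p).
Proof. by move/(coord_bounds 0); rewrite !add0n. Qed.

Lemma north_x_homo w i j : i <= j -> north_x w i <= north_x w j.
Proof.
move=> /subnK <-; elim: (j - i) => [|t IH] //.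
by apply: (leq_trans IH); exact: (north_xs_nondecr 0).
Qed.

Lemma north_x_default w i : count_mem stepN w <= i -> north_x w i = count_mem stepE w.
Proof. by move=> H; rewrite /north_x nth_default // size_north_xs. Qed.

(** A position is the sum of its two coordinates, and monotonicity of [north_x] excludes every row
    other than [y] at position [x + y]. *)
Lemma coord_at w x y : y <= count_mem stepN w -> x <= north_x w y ->
  (0 < y -> north_x w y.-1 <= x) ->
  [/\ x + y <= size w, xcoord w (x + y) = x & ycoord w (x + y) = y].
Proof.
move=> yn xy yx.
have szw : x + y <= size w.
  rewrite -count_steps leq_add //.
  by apply: (leq_trans xy); rewrite -(@north_x_default w (maxn y (count_mem stepN w))) ?north_x_homo ?leq_maxl ?leq_maxr.
have S := coord_sum szw; have [A B] := north_x_bounds szw.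
set x' := xcoord _ _ in S A B *; set y' := ycoord _ _ in S A B *.
suff E : y' = y by split=> //; lia.
case: (ltngtP y' y) => // C.
  have := yx ltac:(lia); have := @north_x_homo w y' y.-1 ltac:(lia); lia.
have := B ltac:(lia); have := @north_x_homo w y y'.-1 ltac:(lia); lia.
Qed.

(* The rows [s, ..., s + r - 1] of the path with height vector [a]. *)
Fixpoint path_of (k : nat) (a : nat -> nat) (s r : nat) : seq bool :=
  if r is r'.+1 then
    stepN :: nseq (a s + k - a s.+1) stepE ++ path_of k a s.+1 r'
  else [::].

Lemma north_xs_nseqE x g : north_xs x (nseq g stepE) = [::].
Proof. by elim: g x => //=. Qed.

Lemma count_north_path_of k a s r : count_mem stepN (path_of k a s r) = r.
Proof.
elim: r s => [|r IH] s //=.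
by rewrite count_cat IH count_nseq /= mul0n.
Qed.

Lemma path_of_facts k a s r : (forall i, i < s + r -> a i.+1 <= a i + k) ->
  (count_mem stepE (path_of k a s r) + a (s + r) = k * r + a s) /\
  forall x d l, l < r ->
    nth d (north_xs x (path_of k a s r)) l + a (s + l) = x + k * l + a s.
Proof.
elim: r s => [|r IH] s Ha /=; first by rewrite addn0 muln0.
have [IH1 IH2] := IH s.+1 ltac:(move=> i Hi; apply: Ha; lia).
have as1 := Ha s ltac:(lia).
split.
  rewrite count_cat count_nseq /= add0n mul1n -addSnnS mulnS -addnA IH1; lia.
move=> x d [|l] Hl /=; first by rewrite addn0 muln0 addn0.
rewrite north_xs_cat north_xs_nseqE count_nseq /= mul1n -addSnnS mulnS.
by rewrite IH2 //; lia.
Qed.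

Lemma mu_path_of n k : mu n k = path_of k (fun=> 0) 0 n.
Proof.
rewrite /mu; elim: n 0 {2}0 => [|n IH] c s //=.
by rewrite (IH c s.+1) addKn.
Qed.

Lemma maxXE n k y : y <= n -> maxX n k y = k * y.
Proof.
move=> yn; rewrite /maxX.
have cN : count_mem stepN (mu n k) = n by rewrite mu_path_of count_north_path_of.
have [cE nx] := @path_of_facts k (fun=> 0) 0 n ltac:(by []).
rewrite -mu_path_of in cE nx.
have Xmu l : l <= n -> north_x (mu n k) l = k * l.
  rewrite leq_eqVlt => /orP[/eqP -> | ln].
    by rewrite north_x_default ?cN // -[LHS]addn0 cE addn0.
  by rewrite -[LHS]addn0 [LHS](nx 0) // addn0.
apply/eqP; rewrite eqn_leq; apply/andP; split.
  apply/bigmax_leqP => p /eqP <-.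
  rewrite -Xmu; first by have [] := north_x_bounds (ltn_ord p : p <= size (mu n k)).
  by rewrite -[leqRHS]cN; apply: ycoord_le.
(* The maximum is attained at the last point of row [y], at position [k * y + y]. *)
have [] := @coord_at (mu n k) (k * y) y.
- by rewrite cN.
- by rewrite Xmu.
- by move=> y0; rewrite Xmu ?leq_mul2l; lia.
rewrite -ltnS => lt_sz Ex Ey.
have := @leq_bigmax_cond _ (fun p : 'I_(size (mu n k)).+1 => ycoord (mu n k) p == y)
  (fun p => xcoord (mu n k) p) (Ordinal lt_sz).
by rewrite /= Ex Ey eqxx; apply.
Qed.

(** * The height vector of a Dyck path *)

Lemma nth_filter_iota d (P : pred nat) N p : p < N -> P p ->
  nth d [seq q <- iota 0 N | P q] (count P (iota 0 p)) = p.
Proof.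
move=> pN Pp; rewrite -(subnKC (ltnW pN)) iotaD filter_cat add0n.
rewrite nth_cat size_filter ltnn subnn.
by case E: (N - p) => [|r] /=; [lia | rewrite Pp].
Qed.

Lemma head_filter_iota d (P : pred nat) s N p : s <= p < s + N -> P p ->
  (forall q, s <= q < p -> ~~ P q) -> head d [seq q <- iota s N | P q] = p.
Proof.
move=> /andP[sp pN] Pp notP.
have -> : N = (p - s) + (N - (p - s)).-1.+1 by lia.
rewrite iotaD filter_cat subnKC //= Pp.
rewrite (_ : [seq q <- iota s (p - s) | P q] = [::]) //.
apply/eqP; rewrite -[_ == _]negbK -has_filter; apply/hasPn => q.
by rewrite mem_iota subnKC //; apply: notP.
Qed.

Lemma xcoordS w p : p < size w -> xcoord w p.+1 = xcoord w p + (nth stepE w p == stepE).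
Proof.
by move=> pw; rewrite /xcoord (take_nth stepE pw) -cats1 count_cat /= addn0.
Qed.

Lemma ycoordS w p : p < size w -> ycoord w p.+1 = ycoord w p + (nth stepE w p == stepN).
Proof.
by move=> pw; rewrite /ycoord (take_nth stepE pw) -cats1 count_cat /= addn0.
Qed.

(* The first row [l > j] with [a l < v], or [n] if there is none; meaningful for [j < n]. *)
Definition nxt (a : nat -> nat) (n v j : nat) : nat :=
  j.+1 + find (fun l => a l < v) (iota j.+1 (n - j.+1)).

Lemma nxtP (a : nat -> nat) n v j : j < n ->
  [/\ j < nxt a n v j <= n, forall l, j < l < nxt a n v j -> v <= a l &
      nxt a n v j < n -> a (nxt a n v j) < v].
Proof.
move=> jn; rewrite /nxt; set s := iota _ _; set P := (fun l => _).
have sz : size s = n - j.+1 by rewrite size_iota.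
have fs : find P s <= n - j.+1 by rewrite -sz find_size.
split; first lia.
  move=> l Hl; have /(before_find 0) : l - j.+1 < find P s by lia.
  by rewrite nth_iota; [rewrite subnKC /P /= ?ltnNge; [move/negbFE|lia] | lia].
move=> lt; have H : has P s by rewrite has_find sz; lia.
by have := nth_find 0 H; rewrite nth_iota; [|lia].
Qed.

Lemma nxt_unique (a : nat -> nat) n v j e : j < e <= n ->
  (forall l, j < l < e -> v <= a l) -> (e < n -> a e < v) -> nxt a n v j = e.
Proof.
move=> je H1 H2; have [A B C] := nxtP a v (ltac:(lia) : j < n).
case: (ltngtP (nxt a n v j) e) => // lt.
  have := H1 (nxt a n v j) ltac:(lia); have := C ltac:(lia); lia.
have := B e ltac:(lia); have := H2 ltac:(lia); lia.
Qed.

(** By [hpath_ht] and [exists_ht] these are exactly the height vectors of Dyck paths; values beyond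
    [n] are free. *)
Definition hpath (k n : nat) (a : nat -> nat) : Prop :=
  [/\ a 0 = 0, a n = 0 & forall i, i < n -> a i.+1 <= a i + k].

Definition raise (a : nat -> nat) (i e l : nat) : nat := a l + (i <= l < e).

Section Heights.
Variables (n k : nat).
Implicit Type D : dyck n k.

(* [l = n] stands for the final point, where [north_x] takes its default value and [ht] is 0. *)
Definition ht D (l : nat) : nat := k * l - north_x (word D) l.

Lemma word_facts D :
  [/\ size (word D) = n + k * n, count_mem stepN (word D) = n,
      count_mem stepE (word D) = k * n &
      forall p, p <= size (word D) -> xcoord (word D) p <= k * ycoord (word D) p].
Proof.
case: D => w /= H; rewrite /word /=; have /and3P[/eqP cN /eqP cE /forallP above] := H.
split=> //; first by rewrite size_tuple.
move=> p pw; have := above (Ordinal (pw : p < (size w).+1)).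
by rewrite /= maxXE // -[leqRHS]cN ycoord_le.
Qed.

Lemma size_word D : size (word D) = n + k * n.
Proof. by case: (word_facts D). Qed.

Lemma count_north D : count_mem stepN (word D) = n.
Proof. by case: (word_facts D). Qed.

Lemma ycoord_le_n D p : ycoord (word D) p <= n.
Proof. by rewrite -[leqRHS](count_north D) ycoord_le. Qed.

Lemma ycoord_size D : ycoord (word D) (size (word D)) = n.
Proof. by rewrite /ycoord take_size count_north. Qed.

Lemma north_point D i : i < n ->
  [/\ i + north_x (word D) i < size (word D),
      xcoord (word D) (i + north_x (word D) i) = north_x (word D) i,
      ycoord (word D) (i + north_x (word D) i) = i &
      nth stepE (word D) (i + north_x (word D) i) = stepN].
Proof.
move=> i_lt; have [|//||] := @coord_at (word D) (north_x (word D) i) i.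
- by rewrite count_north ltnW.
- by move=> _; apply: north_x_homo; lia.
rewrite (addnC i); set p := _ + _ => le_p Ex Ey.
have lt_p : p < size (word D).
  rewrite ltn_neqAle le_p andbT; apply/eqP => E.
  by move: Ey; rewrite E ycoord_size; lia.
(* An east step here would lead to a point of row [i] to the right of [north_x]. *)
split=> //; case E: (nth _ _ _) => //.
have [] := north_x_bounds lt_p.
by rewrite xcoordS // ycoordS // E /= Ex Ey addn0; lia.
Qed.

(** The index of a north step in the filtered list is the number of north steps before it, i.e. its
    [ycoord]. *)
Lemma rposE D (i : 'I_n) : rpos D i = i + north_x (word D) i.
Proof.
have [lt_p _ Ey HN] := north_point D (ltn_ord i).
rewrite /rpos -{1}Ey /ycoord -(@map_nth_iota0 _ stepE) 1?ltnW // count_map.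
by rewrite (@nth_filter_iota _ (fun p => nth stepE (word D) p == stepN)) // HN.
Qed.

Lemma LAE D i : LA D i = north_x (word D) i.
Proof. by rewrite /LA rposE; have [] := north_point D (ltn_ord i). Qed.

Lemma north_x_ht D l : l <= n -> north_x (word D) l + ht D l = k * l.
Proof.
move=> ln; apply: subnKC.
move: ln; rewrite leq_eqVlt => /orP[/eqP -> | ln].
  by have [_ cN cE _] := word_facts D; rewrite north_x_default ?cN ?cE.
have [lt_p Ex Ey _] := north_point D ln.
by have [_ _ _ /(_ _ (ltnW lt_p))] := word_facts D; rewrite Ex Ey.
Qed.

Lemma hpath_ht D : hpath k n (ht D).
Proof.
have [_ cN cE _] := word_facts D.
split.
- by rewrite /ht muln0.
- by rewrite /ht north_x_default ?cN ?cE ?subnn.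
move=> i i_lt; have := north_x_ht D (ltnW i_lt); have := north_x_ht D i_lt.
have := north_x_homo (word D) (leqnSn i); rewrite mulnS; lia.
Qed.

Lemma horizE D p : horiz D p = k * ycoord (word D) p - xcoord (word D) p.
Proof. by rewrite /horiz maxXE // ycoord_le_n. Qed.

Lemma ht_le_horiz D p : p <= size (word D) -> ht D (ycoord (word D) p) <= horiz D p.
Proof.
move=> pw; rewrite horizE // /ht; have [] := north_x_bounds pw; lia.
Qed.

(** Along a row [horiz] decreases to [ht], its value at the last point of the row. The default value
    of [nth] makes the final point not followed by an east step. *)
Lemma followed_by_EE D p : p <= size (word D) ->
  followed_by_E D p = (ht D (ycoord (word D) p) < horiz D p).
Proof.
move=> pw; rewrite /followed_by_E.
move: (pw); rewrite leq_eqVlt => /orP[/eqP -> | lt_p].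
  rewrite nth_default // horizE // ycoord_size.
  have [_ cN cE _] := word_facts D.
  by rewrite /xcoord take_size cE subnn.
rewrite horizE //; set y := ycoord _ _.
have yn : y <= n := ycoord_le_n D p.
have [_ _ _ /(_ _ pw) x_le] := word_facts D; rewrite -/y in x_le.
have [x_le' _] := north_x_bounds pw; rewrite -/y in x_le'.
have := north_x_ht D yn.
have := xcoordS lt_p; have := ycoordS lt_p; rewrite -/y.
rewrite (set_nth_default stepE) //; case: (nth _ _ _) => /= ey ex Xy.
  have [_] := north_x_bounds lt_p; rewrite ey addn1 => /(_ isT) /= B.
  by apply/esym/negbTE; rewrite -leqNgt; lia.
have [B _] := north_x_bounds lt_p; rewrite ey addn0 in B.
by apply/esym; change (ht D y < k * y - xcoord (word D) p); lia.
Qed.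

(** Row [y > 0] is entered at distance [ht D y.-1 + k] and left at [ht D y]; east steps lower the
    distance by one, so every value between occurs. *)
Lemma point_at D y v : y <= n -> ht D y <= v <= k * y ->
    (0 < y -> v <= ht D y.-1 + k) ->
  let p := k * y - v + y in
  [/\ p <= size (word D), xcoord (word D) p = k * y - v,
      ycoord (word D) p = y & horiz D p = v].
Proof.
move=> yn /andP[v1 v2] v3.
have X1 := north_x_ht D yn.
have [|||le_p Ex Ey] := @coord_at (word D) (k * y - v) y.
- by rewrite count_north.
- lia.
- case: y yn v1 v2 v3 X1 => // y yn v1 v2 v3 X1 _ /=.
  have /= := v3 isT; have := @north_x_ht D y ltac:(lia); rewrite mulnS; lia.
by split=> //; rewrite horizE // Ex Ey subKn.
Qed.

Lemma preceded_by_EE D (i : 'I_n) :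
  preceded_by_E D (rpos D i) = (0 < i) && (ht D i < ht D i.-1 + k).
Proof.
have [lt_p Ex Ey HN] := north_point D (ltn_ord i).
rewrite /preceded_by_E rposE; have i_n := ltn_ord i.
have [a0 _ aS] := hpath_ht D.
have Xi := @north_x_ht D i (ltnW (ltn_ord i)).
case: (posnP i) => [i0|i_gt0].
  by move: Xi; rewrite i0 muln0 add0n => /eqP; rewrite addn_eq0 => /andP[/eqP ->].
rewrite addn_gt0 i_gt0 /=; apply/idP/idP.
  set p := _.-1 => HE; have lt_p' : p < size (word D) by lia.
  have pS : p.+1 = i + north_x (word D) i by rewrite /p; lia.
  have := xcoordS lt_p'; have := ycoordS lt_p'.
  rewrite (set_nth_default stepN) // (eqP HE) /= addn0 addn1 pS Ex Ey => ey ex.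
  have [_] := north_x_bounds (ltnW lt_p'); rewrite -ey => /(_ i_gt0).
  have := @north_x_ht D i.-1 ltac:(lia).
  have : k * i = k * i.-1 + k by rewrite -{1}(prednK i_gt0) mulnS addnC.
  lia.
move=> lt_ht.
have Hk : k * i = k * i.-1 + k by rewrite -{1}(prednK i_gt0) mulnS addnC.
have Xi1 := @north_x_ht D i.-1 ltac:(lia).
have Xh := @north_x_homo (word D) i.-1 i ltac:(lia).
(* This is the point of row [i] one unit to the left of [r_i]. *)
have [||le_p' _ Ey' Eh'] := @point_at D i (ht D i).+1 (ltnW (ltn_ord i)); [lia|lia|].
have := followed_by_EE le_p'; rewrite Ey' Eh' ltnSn /followed_by_E => H.
by rewrite (_ : _.-1 = k * i - (ht D i).+1 + i) //; lia.
Qed.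

Lemma followed_by_NE D (i : 'I_n) : followed_by_N D (rpos D i).
Proof.
have [_ _ _ HN] := north_point D (ltn_ord i).
by rewrite /followed_by_N rposE HN.
Qed.

(* The point on row [e] at horizontal distance [ht D i]. *)
Definition endpos D (i e : nat) : nat := k * e - ht D i + e.

Lemma ht_le D i : i <= n -> ht D i <= k * i.
Proof. by move=> le_in; rewrite -(north_x_ht D le_in) leq_addl. Qed.

Lemma endposP D (i v : nat) : i < n -> ht D i <= v <= (ht D i).+1 ->
  let e := nxt (ht D) n v i in
  [/\ i + north_x (word D) i < endpos D i e <= size (word D),
      xcoord (word D) (endpos D i e) = k * e - ht D i,
      ycoord (word D) (endpos D i e) = e & horiz D (endpos D i e) = ht D i].
Proof.
move=> i_lt Hv e.
have [He1 He2 He3] := nxtP (ht D) v i_lt; rewrite -/e in He1 He2 He3.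
have [a0 an aS] := hpath_ht D.
have hi := @ht_le D i ltac:(lia).
have Xi := @north_x_ht D i ltac:(lia).
have kie : k * i + k <= k * e by rewrite addnC -mulnS leq_mul2l; lia.
have ae : ht D e <= ht D i.
  by case: (ltngtP e n) He1 => [/He3||->]; lia.
have ae1 : ht D i <= ht D e.-1.
  case: (ltngtP e i.+1) He1 => // [lt|->] // _; last first.
  have := He2 e.-1 ltac:(lia); lia.
have [||le_p Ex Ey Eh] := @point_at D e (ht D i) ltac:(lia); [lia|lia|].
by split=> //; rewrite /endpos; lia.
Qed.

(** On row [e] itself the distance is still above [ht D i] before [endpos] is reached. *)
Lemma before_endpos D (i v q : nat) : i < n -> ht D i <= v <= (ht D i).+1 ->
  let e := nxt (ht D) n v i in
  i + north_x (word D) i < q < endpos D i e ->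
  ht D i < horiz D q \/ i < ycoord (word D) q < e.
Proof.
move=> i_lt Hv e Hq.
have [H1 Ex Ey Eh] := endposP i_lt Hv; rewrite -/e in H1 Ex Ey Eh.
have q_le : q <= size (word D) by lia.
have S := coord_sum q_le; have [B1 B2] := north_x_bounds q_le.
have Se := coord_sum (ltac:(lia) : endpos D i e <= size (word D)).
have [He1 He2 He3] := nxtP (ht D) v i_lt; rewrite -/e in He1 He2 He3.
have ae : ht D e <= ht D i.
  have [_ an _] := hpath_ht D.
  by case: (ltngtP e n) He1 => [/He3||->]; lia.
have Xe := @north_x_ht D e ltac:(lia).
rewrite horizE //; move: S B1 B2; set x := xcoord _ _; set y := ycoord _ _ => S B1 B2.
case: (ltngtP y e) => Cye.
- case: (ltnP i y) => Ciy; first by right.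
  by have := north_x_homo (word D) Ciy; lia.
- have := @north_x_homo (word D) e y.-1 ltac:(lia); have := B2 ltac:(lia).
  by rewrite /endpos in Hq; lia.
by left; rewrite Cye; rewrite /endpos in Hq; lia.
Qed.

Lemma tposE D (i : 'I_n) : tpos D i = endpos D i (nxt (ht D) n (ht D i).+1 i).
Proof.
have Hv : ht D i <= (ht D i).+1 <= (ht D i).+1 by lia.
have [H1 Ex Ey Eh] := endposP (ltn_ord i) Hv.
have [lt_p _ Eyi _] := north_point D (ltn_ord i).
have Xi := @north_x_ht D i (ltnW (ltn_ord i)).
have hr : horiz D (rpos D i) = ht D i.
  by rewrite rposE horizE Eyi; have [_ -> _ _] := north_point D (ltn_ord i).
rewrite /tpos; apply: head_filter_iota.
- by rewrite rposE; lia.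
- by rewrite hr Eh.
move=> q; rewrite hr rposE => Hq.
have [He1 He2 He3] := nxtP (ht D) (ht D i).+1 (ltn_ord i).
have [|H|H] := before_endpos (ltn_ord i) Hv (q := q); [lia|lia|].
by have := He2 _ H; have := @ht_le_horiz D q ltac:(lia); lia.
Qed.

(** The rows between have height at least [ht D i], so a point at this distance there is the last of
    its row and is followed by a north step. *)
Lemma hposE D (i : 'I_n) : hpos D i = endpos D i (nxt (ht D) n (ht D i) i).
Proof.
have Hv : ht D i <= ht D i <= (ht D i).+1 by lia.
have [H1 Ex Ey Eh] := endposP (ltn_ord i) Hv.
have [lt_p _ Eyi _] := north_point D (ltn_ord i).
have Xi := @north_x_ht D i (ltnW (ltn_ord i)).
have hr : horiz D (rpos D i) = ht D i.
  by rewrite rposE horizE Eyi; have [_ -> _ _] := north_point D (ltn_ord i).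
have [He1 He2 He3] := nxtP (ht D) (ht D i) (ltn_ord i).
have [a0 an aS] := hpath_ht D.
rewrite /hpos; apply: head_filter_iota.
- by rewrite rposE; lia.
- rewrite hr Eh eqxx followed_by_EE ?Eh ?Ey; last lia.
  case: (ltngtP (nxt (ht D) n (ht D i) i) n) => [/He3 -> //|lt|en].
    by lia.
  (* On row [n] the point is followed by an east step unless its distance is 0, and then it is the
     final point. *)
  rewrite en an size_word /endpos; case: (posnP (ht D i)) => [->|_] //.
  by rewrite subn0 addnC eqxx.
move=> q; rewrite hr rposE => Hq.
have [|H|H] := before_endpos (ltn_ord i) Hv (q := q); [lia| |].
  by rewrite gtn_eqF.
have qs : q <= size (word D) by lia.
rewrite followed_by_EE //; have := He2 _ H; have := ht_le_horiz qs; lia.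
Qed.

(** A hit point on a row [e <= i] is followed by an east step, hence strictly left of [r_i]; if
    [i < e], then [r_i] is passed earlier on the path. *)
Lemma comes_before_hpos D (i j : 'I_n) :
  comes_before D (hpos D j) (rpos D i) = (nxt (ht D) n (ht D j) j <= i).
Proof.
have Hv : ht D j <= ht D j <= (ht D j).+1 by lia.
have [H1 Ex Ey Eh] := endposP (ltn_ord j) Hv.
have [He1 He2 He3] := nxtP (ht D) (ht D j) (ltn_ord j).
rewrite /comes_before -/(LA D i) LAE hposE Ex.
move: (nxt _ _ _ _) H1 Ex Ey Eh He1 He2 He3 => e H1 Ex Ey Eh He1 He2 He3.
have Xe := @north_x_ht D e ltac:(lia).
have hj : ht D j <= k * e.
  by apply: (leq_trans (ht_le D (ltnW (ltn_ord j)))); rewrite leq_mul2l; lia.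
have [_ B] := @north_x_bounds (word D) (endpos D j e) ltac:(lia).
case: (leqP e i) => C; apply/idP/idP => //.
  have := north_x_homo (word D) C; have := He3 ltac:(have := ltn_ord i; lia); lia.
have := @north_x_homo (word D) i e.-1 ltac:(lia); rewrite Ex Ey in B.
have := B ltac:(lia); lia.
Qed.

End Heights.

(** * Steps as operations on height vectors *)

(* [d = 1] describes the Tamari steps and [d = 0] the greedy steps. *)
Definition step (d k n : nat) (a a' : nat -> nat) (i : nat) : Prop :=
  [/\ 0 < i < n, a i < a i.-1 + k &
      forall l, l <= n -> a' l = raise a i (nxt a n (d + a i) i) l].

Section Slides.
Variables (n k : nat).
Implicit Type D : dyck n k.

Lemma size_slide D a b : 0 < a < b -> b <= size (word D) ->
  size (slide D a b) = size (word D).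
Proof.
move=> Hab Hb; rewrite /slide !size_cat /= size_drop size_drop !size_takel; lia.
Qed.

(** Here [w] need not be known to be a Dyck path; it will be the result of a slide. *)
Lemma eq_ht_word D (w : seq bool) :
    size w = size (word D) -> count_mem stepN w = n ->
    (forall l, l < n -> north_x w l + ht D l = k * l) ->
  word D = w.
Proof.
move=> sz cN H; apply: (@north_xs_inj 0) => //.
have cE : count_mem stepE w = count_mem stepE (word D).
  by have := count_steps w; have := count_steps (word D); rewrite count_north; lia.
apply: (@eq_from_nth _ (count_mem stepE w)); first by rewrite !size_north_xs count_north.
move=> l; rewrite size_north_xs count_north => ln.
rewrite {1}cE -!/(north_x _ _); apply: (@addIn (ht D l)).
by rewrite H // north_x_ht // ltnW.
Qed.

Lemma ht_inj D D' : (forall l, l < n -> ht D l = ht D' l) -> D = D'.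
Proof.
move=> H; apply/val_inj/val_inj; apply: eq_ht_word.
- by rewrite -!/(word _) !size_word.
- exact: count_north.
by move=> l ln; rewrite H // north_x_ht // ltnW.
Qed.

(** The north steps of the moved segment are those of the rows from [i] up to the row of [b],
    exclusive; the east step that passes behind them shifts each one unit to the left. *)
Lemma north_x_slide D (i : 'I_n) b l : preceded_by_E D (rpos D i) ->
  rpos D i < b <= size (word D) -> l < n ->
  north_x (slide D (rpos D i) b) l + (i <= l < ycoord (word D) b)
  = north_x (word D) l.
Proof.
move=> /andP[p_gt0 pE] /andP[pb b_le] ln.
have [lt_p Ex Ey _] := north_point D (ltn_ord i); rewrite -rposE in lt_p Ex Ey.
move: (rpos D i) p_gt0 pE pb lt_p Ex Ey => p p_gt0 pE pb lt_p Ex Ey.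
set w := word D in b_le pE lt_p Ex Ey *.
set s := drop p (take b w); set d := take p.-1 w; set f := drop b w.
have dE : take p w = rcons d stepE.
  by rewrite -{1}(prednK p_gt0) (take_nth stepN) ?(eqP pE) //; lia.
have wE : w = d ++ stepE :: s ++ f.
  rewrite -{1}(cat_take_drop b w) -{1}(cat_take_drop p (take b w)).
  by rewrite take_takel ?(ltnW pb) // dE -!cats1 -!catA.
have szd : count_mem stepN d = i.
  by move: Ey; rewrite /ycoord dE -cats1 count_cat /= !addn0.
have szs : i + count_mem stepN s = ycoord w b.
  by rewrite /ycoord -(cat_take_drop p (take b w)) take_takel ?(ltnW pb) // count_cat -Ey.
rewrite -szs /north_x /slide -/w -/s -/d -/f wE.
rewrite !north_xs_cat /= !north_xs_cat !add0n !count_cat /= !count_cat.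
set x := count_mem stepE d; set y := count_mem stepE s.
rewrite addSn [1 + (y + _)]addnCA !nth_cat !size_north_xs szd.
case: (ltnP l i) => li; first by rewrite addn0.
case: (ltnP (l - i) (count_mem stepN s)) => ls.
  rewrite north_xsS (nth_map 0) ?size_north_xs // -ltn_subLR // ls.
  by rewrite addn1; congr S; apply: set_nth_default; rewrite size_north_xs.
by rewrite -ltn_subLR // ltnNge ls addn0.
Qed.

Lemma slide_ht D D' (i : 'I_n) b : preceded_by_E D (rpos D i) ->
    rpos D i < b <= size (word D) ->
  word D' = slide D (rpos D i) b <->
  (forall l, l <= n -> ht D' l = raise (ht D) i (ycoord (word D) b) l).
Proof.
move=> HE Hb; have e_le := ycoord_le_n D b; set e := ycoord _ _ in e_le *.
have p_gt0 : 0 < rpos D i by case/andP: HE.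
have Hs l := @north_x_slide D i b l HE Hb.
rewrite -/e in Hs.
have [_ an _] := hpath_ht D; have [_ an' _] := hpath_ht D'.
split=> [Ew l | Hh].
  rewrite /raise leq_eqVlt => /orP[/eqP -> | ln].
    by rewrite an an' ltnNge e_le andbF.
  have := Hs l ln; rewrite -Ew; have := north_x_ht D (ltnW ln).
  by have := north_x_ht D' (ltnW ln); lia.
apply: eq_ht_word.
- by case/andP: Hb => pb b_le; rewrite size_slide ?p_gt0 // !size_word.
- have C1 : count_mem stepN (take (rpos D i) (word D)) =
             count_mem stepN (take (rpos D i).-1 (word D)).
    case/andP: HE => _ /eqP HE; rewrite -{1}(prednK p_gt0) (take_nth stepN); last lia.
    by rewrite HE -cats1 count_cat /= !addn0.
  have C2 := congr1 (count_mem stepN) (cat_take_drop (rpos D i) (take b (word D))).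
  have C3 := congr1 (count_mem stepN) (cat_take_drop b (word D)).
  rewrite take_takel ?count_cat ?C1 in C2; last by case/andP: Hb => /ltnW.
  by rewrite count_cat -C2 count_north in C3; rewrite /slide !count_cat /= add0n addnA.
move=> l ln; have := Hs l ln; have := north_x_ht D (ltnW ln).
by rewrite Hh ?(ltnW ln) // /raise; lia.
Qed.

Lemma tamari_stepP D D' :
  reflect (exists i, step 1 k n (ht D) (ht D') i) (tamari_step D D').
Proof.
have endp (i : 'I_n) : [/\ rpos D i < tpos D i <= size (word D) &
    ycoord (word D) (tpos D i) = nxt (ht D) n (1 + ht D i) i].
  have [|H _ Ey _] := @endposP n k D i (1 + ht D i) (ltn_ord i); first lia.
  by rewrite tposE rposE.
apply: (iffP existsP) => [[i /andP[HE /eqP Ew]] | [i [i_n lt_i Hh]]].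
  have [Hb Ey] := endp i; have := HE; rewrite preceded_by_EE => /andP[i_gt0 lt_i].
  exists i; split=> //; first by rewrite i_gt0 ltn_ord.
  by rewrite -Ey; apply/(slide_ht _ HE Hb).
case/andP: i_n => i_gt0 i_n.
have HE : preceded_by_E D (rpos D (Ordinal i_n)) by rewrite preceded_by_EE i_gt0.
exists (Ordinal i_n); have [Hb Ey] := endp (Ordinal i_n).
by rewrite HE; apply/eqP/(slide_ht _ HE Hb); rewrite Ey.
Qed.

Lemma greedy_stepP D D' :
  reflect (exists i, step 0 k n (ht D) (ht D') i) (greedy_step D D').
Proof.
have endp (i : 'I_n) : [/\ rpos D i < hpos D i <= size (word D) &
    ycoord (word D) (hpos D i) = nxt (ht D) n (0 + ht D i) i].
  have [|H _ Ey _] := @endposP n k D i (0 + ht D i) (ltn_ord i); first lia.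
  by rewrite hposE rposE.
apply: (iffP existsP) => [[i /and3P[HE _ /eqP Ew]] | [i [i_n lt_i Hh]]].
  have [Hb Ey] := endp i; have := HE; rewrite preceded_by_EE => /andP[i_gt0 lt_i].
  exists i; split=> //; first by rewrite i_gt0 ltn_ord.
  by rewrite -Ey; apply/(slide_ht _ HE Hb).
case/andP: i_n => i_gt0 i_n.
have HE : preceded_by_E D (rpos D (Ordinal i_n)) by rewrite preceded_by_EE i_gt0.
exists (Ordinal i_n); have [Hb Ey] := endp (Ordinal i_n).
by rewrite HE followed_by_NE; apply/eqP/(slide_ht _ HE Hb); rewrite Ey.
Qed.

Lemma exists_ht a : hpath k n a -> exists D, forall l, l <= n -> ht D l = a l.
Proof.
move=> [a0 an aS].
have [] := @path_of_facts k a 0 n aS; rewrite add0n a0 an !addn0 => cE nx.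
have cN := count_north_path_of k a 0 n.
set w := path_of k a 0 n in cE nx cN.
have szw : size w == n + k * n by rewrite -count_steps cN cE addnC.
have Xw l : l <= n -> north_x w l + a l = k * l.
  rewrite leq_eqVlt => /orP[/eqP -> | ln]; last by rewrite nx // addn0.
  by rewrite an north_x_default ?cN // cE addn0.
have D_ok : is_dyck n k (Tuple szw).
  rewrite /is_dyck /= cN cE !eqxx /=; apply/forallP => p /=.
  have yn : ycoord w p <= n by rewrite -[leqRHS]cN ycoord_le.
  have [H _] := north_x_bounds (ltn_ord p : p <= size w).
  by rewrite maxXE //; have := Xw _ yn; lia.
exists (exist _ (Tuple szw) D_ok) => l ln; rewrite /ht -(Xw l ln).
by rewrite /word /= addKn.
Qed.

End Slides.

(** * Ancestors and the maps phi and psi *)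

Lemma leq_sum_nat m n (E1 E2 : nat -> nat) :
    (forall i, m <= i < n -> E1 i <= E2 i) ->
  \sum_(m <= i < n) E1 i <= \sum_(m <= i < n) E2 i.
Proof. by move=> H; rewrite big_nat [leqRHS]big_nat; apply: leq_sum. Qed.

(* In the vector of a path of maximal in-degree the ancestors of [i] are given by [d = 1],
   in its image under [phi] by [d = 0]; larger [d] serve to compare Tamari-related paths. *)
Definition anc (d : nat) (a : nat -> nat) (j i : nat) : bool :=
  all (fun l => d + a j <= a l) (iota j.+1 (i - j)).

Lemma ancP d a j i : reflect (forall l, j < l <= i -> d + a j <= a l) (anc d a j i).
Proof.
by apply: (iffP allP) => H l Hl; apply: H; move: Hl; rewrite mem_iota; lia.
Qed.

Lemma anc_nxt d a n j i : j < n -> i < n -> anc d a j i = (i < nxt a n (d + a j) j).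
Proof.
move=> jn i_n; have [A B C] := nxtP a (d + a j) jn.
apply/ancP/idP => [H | H l Hl]; last by apply: B; lia.
rewrite ltnNge; apply/negP => le.
by have := H (nxt a n (d + a j) j) ltac:(lia); have := C ltac:(lia); lia.
Qed.

Definition dep (d : nat) (a : nat -> nat) (i : nat) : nat :=
  \sum_(0 <= j < i) anc d a j i.

(** Heights increase strictly along the ancestors of [i] and stay below [a i], so those of height at
    least [v] take distinct values in [[v, a i)]. *)
Lemma anc_count_le a v i : v <= a i ->
  v + \sum_(0 <= j < i) (anc 1 a j i && (v <= a j)) <= a i.
Proof.
suff H t : t <= i -> forall v, v <= a i ->
    v + \sum_(i - t <= j < i) (anc 1 a j i && (v <= a j)) <= a i.
  by have := H i (leqnn i) v; rewrite subnn.
elim: t => [|t IH] ti {}v va; first by rewrite subn0 big_geq // addn0.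
rewrite big_ltn; last lia.
rewrite (_ : (i - t.+1).+1 = i - t); last lia.
have IHt := IH (ltnW ti).
case: (boolP (_ && _)) => [/andP[/ancP A le_v] | _] /=; last by rewrite add0n IHt.
have le_v1 : v.+1 <= a i.
  have := A i ltac:(lia); lia.
apply: leq_trans (IHt _ le_v1); rewrite addnCA add1n addSn ltnS leq_add2l.
apply: leq_sum_nat => j Hj; case: (boolP (anc 1 a j i)) => // _ /=.
by have := A j ltac:(lia); case: (v <= a j) => //; lia.
Qed.

(** Hence the subtraction in [phi] never truncates. *)
Lemma dep_le a i : dep 1 a i <= a i.
Proof.
have := anc_count_le (leq0n (a i)); rewrite add0n; apply: leq_trans.
by apply: leq_sum_nat => j _; rewrite leq0n andbT.
Qed.

Lemma dep_split d a j i : j <= i ->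
  dep d a i = \sum_(0 <= p < j) anc d a p i + \sum_(j <= p < i) anc d a p i.
Proof. by move=> ji; rewrite /dep (@big_cat_nat _ _ _ j). Qed.

(* The height vectors of the paths of maximal in-degree, see [dyck_inP]. *)
Definition primitive (n : nat) (a : nat -> nat) : Prop :=
  forall i, 0 < i < n -> a (nxt a n (a i).+1 i) < a i.

Definition phi (a : nat -> nat) (i : nat) : nat := a i - dep 1 a i.

Section Phi.
Variables (k n : nat) (a : nat -> nat).
Hypotheses (Ha : hpath k n a) (Pa : primitive n a).

Lemma primitive_pos i : 0 < i < n -> 0 < a i.
Proof. by move/Pa; apply: leq_ltn_trans. Qed.

(** The ancestors of [i] are [j], ancestors of [j], and rows between [j] and [i] higher than [a j],
    of which there are fewer than [a i - a j]. *)
Lemma phi_anc j i : j < i -> anc 1 a j i -> phi a j <= phi a i.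
Proof.
move=> ji A; have /ancP A' := A.
have D1 : \sum_(0 <= p < j.+1) anc 1 a p i <= dep 1 a j + 1.
  rewrite big_nat_recr //= A leq_add2r; apply: leq_sum_nat => p Hp.
  by case: (boolP (anc 1 a p i)) => // /ancP H; rewrite (introT (ancP _ _ _ _)) // => l Hl; apply: H; lia.
have D2 : \sum_(j.+1 <= p < i) anc 1 a p i <= \sum_(0 <= p < i) (anc 1 a p i && (a j < a p)).
  rewrite [leqRHS](@big_cat_nat _ _ _ j.+1) //= -[leqLHS]add0n leq_add //.
  apply: leq_sum_nat => p Hp; rewrite (_ : a j < a p) ?andbT //.
  by have := A' p ltac:(lia).
have := @anc_count_le a (a j).+1 i ltac:(have := A' i ltac:(lia); lia).
have := @dep_split 1 a j.+1 i ji; have := dep_le a j; have := dep_le a i.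
rewrite /phi; lia.
Qed.

(** An ancestor of [j] is either an ancestor of [l] or higher than [a l]; fewer than [a j - a l] are
    of the second kind. *)
Lemma phi_not_anc j i : j < i < n -> ~~ anc 1 a j i ->
  let l := nxt a n (1 + a j) j in [/\ j < l <= i, a l < a j & phi a l < phi a j].
Proof.
move=> Hji nA l; have [a0 an aS] := Ha.
have [N1 N2 N3] := nxtP a (1 + a j) (ltac:(lia) : j < n); rewrite -/l in N1 N2 N3.
have li : l <= i by move: nA; rewrite (@anc_nxt _ _ n) -?leqNgt //; lia.
have j_gt0 : 0 < j.
  rewrite lt0n; apply/eqP => j0; have := N3 ltac:(lia).
  by have := @primitive_pos l ltac:(lia); rewrite j0 a0; lia.
have al : a l < a j by apply: Pa; lia.
split=> //; first lia.
have D1 : dep 1 a j <= \sum_(0 <= p < j) anc 1 a p l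
                     + \sum_(0 <= p < j) (anc 1 a p j && ((a l).+1 <= a p)).
  rewrite -big_split /=; apply: leq_sum_nat => p Hp.
  case: (boolP (anc 1 a p j)) => //= /ancP Ap.
  case: (ltngtP (a l) (a p)) => C; rewrite ?addn1 ?addn0 //.
    rewrite (introT (ancP _ _ _ _)) // => q Hq.
    case: (leqP q j) => qj; first by apply: Ap; lia.
    case: (ltngtP q l) => ql; [have := N2 q ltac:(lia)| |rewrite ql]; lia.
  (* The remaining case [a p = a l] contradicts primitivity at [p], whose next row of height at most
     [a p] would be [l]. *)
  have p_gt0 : 0 < p.
    rewrite lt0n; apply/eqP => p0.
    by have := @primitive_pos l ltac:(lia); rewrite C p0 a0.
  have E : nxt a n (a p).+1 p = l.
    apply: nxt_unique; [lia| |lia] => q Hq.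
    case: (leqP q j) => qj; first by apply: Ap; lia.
    have := N2 q ltac:(lia); lia.
  by have := Pa (ltac:(lia) : 0 < p < n); rewrite E; lia.
have := @dep_split 1 a j l ltac:(lia).
have := anc_count_le al; have := dep_le a j; have := dep_le a l.
rewrite /phi; lia.
Qed.

Lemma phi_anc_eq j i : j < i < n -> anc 0 (phi a) j i = anc 1 a j i.
Proof.
move=> Hji; apply/idP/idP => [/ancP H | /ancP H].
  apply: contraT => nA; have [/= H1 _ H2] := phi_not_anc Hji nA.
  by have := H _ H1; lia.
apply/ancP => l Hl; apply: phi_anc; first lia.
by apply/ancP => q Hq; apply: H; lia.
Qed.

Lemma dep_phi i : i < n -> dep 0 (phi a) i = dep 1 a i.
Proof. by move=> i_n; apply: eq_big_nat => j Hj; rewrite phi_anc_eq //; lia. Qed.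

(** If [i] is an ancestor of [i + 1], the depth grows by at least 1, which pays for the smaller
    slope; otherwise [phi] decreases. *)
Lemma hpath_phi : 0 < k -> hpath k.-1 n (phi a).
Proof.
move=> k_gt0; have [a0 an aS] := Ha; split; rewrite /phi ?a0 ?an // => i i_n.
case: (ltngtP i.+1 n) i_n => // [i_n|i_n] _; last by rewrite i_n an.
case: (boolP (anc 1 a i i.+1)) => [A|].
  have D1 : dep 1 a i + 1 <= dep 1 a i.+1.
    rewrite [leqRHS]/dep big_nat_recr //= A leq_add2r; apply: leq_sum_nat => p Hp.
    case: (boolP (anc 1 a p i)) => // /ancP Ap; rewrite (introT (ancP _ _ _ _)) // => q Hq.
    case: (leqP q i) => qi; first by apply: Ap; lia.
    have := Ap i ltac:(lia); move/ancP: A => /(_ q ltac:(lia)); lia.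
  have := aS i ltac:(lia); have := dep_le a i; lia.
move=> nA; have [/= H1 _] := phi_not_anc (ltac:(lia) : i < i.+1 < n) nA.
rewrite (_ : nxt _ _ _ _ = i.+1); [rewrite /phi; lia | lia].
Qed.

End Phi.

(** The final point must keep height 0 although row 0 is an ancestor of it for [d = 0]; hence the
    cut at [n]. *)
Definition psi (n : nat) (b : nat -> nat) (i : nat) : nat :=
  if i < n then b i + dep 0 b i else 0.

Lemma psi_phi k n a i : hpath k n a -> primitive n a -> i < n -> psi n (phi a) i = a i.
Proof.
move=> Ha Pa i_n; rewrite /psi i_n (dep_phi Ha Pa) //.
by have := dep_le a i; rewrite /phi; lia.
Qed.

Section Psi.
Variables (k n : nat) (b : nat -> nat).
Hypothesis Hb : hpath k.-1 n b.

(** By transitivity [j] and all its ancestors are ancestors of [i], so the depth grows strictly. *)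
Lemma psi_anc j i : j < i < n -> anc 0 b j i -> psi n b j < psi n b i.
Proof.
move=> Hji A; have /ancP A' := A.
have D1 : dep 0 b j + 1 <= dep 0 b i.
  rewrite (@dep_split 0 b j.+1 i); last lia.
  apply: leq_trans (leq_addr _ _).
  rewrite big_nat_recr //= A leq_add2r; apply: leq_sum_nat => p Hp.
  case: (boolP (anc 0 b p j)) => // /ancP Ap; rewrite (introT (ancP _ _ _ _)) // => q Hq.
  case: (leqP q j) => qj; first by apply: Ap; lia.
  have := A' q ltac:(lia); have := Ap j ltac:(lia); lia.
have [jn i_n] : j < n /\ i < n by lia.
rewrite /psi jn i_n.
have := A' i ltac:(lia); lia.
Qed.

(** No row from [j] to [l - 1] is an ancestor of the lower row [l], so the ancestors of [l] are
    among those of [j]. *)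
Lemma psi_not_anc j i : j < i < n -> ~~ anc 0 b j i ->
  let l := nxt b n (b j) j in j < l <= i /\ psi n b l < psi n b j.
Proof.
move=> Hji nA l.
have [N1 N2 N3] := nxtP b (b j) (ltac:(lia) : j < n); rewrite -/l in N1 N2 N3.
have li : l <= i by move: nA; rewrite (@anc_nxt _ _ n) -?leqNgt //; lia.
split; first lia.
have bl := N3 ltac:(lia).
have D1 : dep 0 b l <= dep 0 b j.
  rewrite (@dep_split 0 b j l); last lia.
  rewrite [X in _ + X]big_nat_cond [X in _ + X]big1; last first.
    move=> p Hp; apply/eqP; rewrite eqb0; apply/ancP => /(_ l ltac:(lia)).
    by case: (ltngtP p j) Hp => [||->]; [lia| move=> pj Hp; have := N2 p ltac:(lia) |]; lia.
  rewrite addn0; apply: leq_sum_nat => p Hp.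
  by case: (boolP (anc 0 b p l)) => // /ancP Ap; rewrite (introT (ancP _ _ _ _)) // => q Hq; apply: Ap; lia.
have [jn ln] : j < n /\ l < n by lia.
by rewrite /psi jn ln; lia.
Qed.

Lemma psi_anc_eq j i : j < i < n -> anc 1 (psi n b) j i = anc 0 b j i.
Proof.
move=> Hji; apply/idP/idP => [/ancP H | /ancP H].
  apply: contraT => nA; have [/= H1 H2] := psi_not_anc Hji nA.
  by have := H _ H1; lia.
apply/ancP => l Hl; apply: psi_anc; first lia.
by apply/ancP => q Hq; apply: H; lia.
Qed.

Lemma dep_psi i : i < n -> dep 1 (psi n b) i = dep 0 b i.
Proof. by move=> i_n; apply: eq_big_nat => j Hj; rewrite psi_anc_eq //; lia. Qed.

Lemma phi_psi i : i < n -> phi (psi n b) i = b i.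
Proof. by move=> i_n; rewrite /phi dep_psi // /psi i_n addnK. Qed.

(** Passing from [i] to [i + 1] can add only [i] itself as an ancestor, so the slope grows by at
    most 1. *)
Lemma hpath_psi : 0 < k -> 0 < n -> hpath k n (psi n b).
Proof.
move=> k_gt0 n_gt0; have [b0 bn bS] := Hb; split.
- by rewrite /psi n_gt0 b0 /dep big_geq.
- by rewrite /psi ltnn.
move=> i i_n; rewrite /psi i_n; case: ltnP => // i1_n.
have D1 : dep 0 b i.+1 <= dep 0 b i + 1.
  rewrite [leqLHS]/dep big_nat_recr //= leq_add //; last by case: anc.
  apply: leq_sum_nat => p Hp.
  by case: (boolP (anc 0 b p i.+1)) => // /ancP Ap; rewrite (introT (ancP _ _ _ _)) // => q Hq; apply: Ap; lia.
have := bS i i_n; lia.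
Qed.

Lemma primitive_psi : primitive n (psi n b).
Proof.
move=> i Hi; have [b0 _ _] := Hb; set l := nxt _ _ _ _.
have [N1 N2 N3] := nxtP (psi n b) (psi n b i).+1 (ltac:(lia) : i < n); rewrite -/l in N1 N2 N3.
have i_n : i < n by lia.
have [l_n|l_n|l_n] := ltngtP l n; last 2 first.
- lia.
(* Row 0 has height 0 and is an ancestor of [i], so [psi n b i] is positive. *)
- rewrite l_n {1}/psi ltnn; apply: leq_ltn_trans (leq0n (psi n b 0)) _.
  by apply: psi_anc => //; apply/ancP => q _; rewrite b0.
have nA : ~~ anc 0 b i l.
  by apply/negP => A; have := psi_anc (ltac:(lia) : i < l < n) A; have := N3 l_n; lia.
have [/= H1 H2] := psi_not_anc (ltac:(lia) : i < l < n) nA.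
set l' := nxt b n (b i) i in H1 H2.
suff -> : l = l' by [].
case: (ltngtP l' l) => // C; last lia.
by have := N2 l' ltac:(lia); lia.
Qed.

End Psi.

(** * Steps, covers and inclusion of ancestor relations *)

Lemma hpath_raise k n a i e : hpath k n a -> 0 < i < e -> e <= n ->
  a i < a i.-1 + k -> hpath k n (raise a i e).
Proof.
move=> [a0 an aS] Hi en lt_i; split; rewrite /raise; [lia|lia|].
move=> j jn; have aj := aS j jn.
case: (j =P i.-1) => [E|]; last by lia.
by rewrite E prednK; lia.
Qed.

Lemma eq_anc d a a' j i : j <= i -> (forall l, l <= i -> a l = a' l) ->
  anc d a j i = anc d a' j i.
Proof.
move=> ji E; apply: eq_in_all => l; rewrite mem_iota => Hl.
by rewrite !E //; lia.
Qed.

Lemma eq_dep d a a' i : (forall l, l <= i -> a l = a' l) -> dep d a i = dep d a' i.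
Proof. by move=> E; apply: eq_big_nat => j Hj; rewrite (eq_anc _ _ E) //; lia. Qed.

Lemma eq_psi n b b' i : (forall l, l <= i -> b l = b' l) -> psi n b i = psi n b' i.
Proof. by move=> E; rewrite /psi (eq_dep _ E) E. Qed.

Lemma psi_mono n b b' i : i < n -> (forall l, l < i -> b l = b' l) -> b i < b' i ->
  psi n b i < psi n b' i.
Proof.
move=> i_n E lt_i; rewrite /psi i_n -addSn leq_add //.
apply: leq_sum_nat => j Hj; case: (boolP (anc 0 b j i)) => // /ancP A.
rewrite (introT (ancP _ _ _ _)) // => l Hl; rewrite -(E j); last lia.
have := A l Hl; case: (ltnP l i) => li; first by rewrite (E l).
by rewrite (_ : l = i); lia.
Qed.

(** The raised rows share their ancestors left of [i]. Besides the explicit 1, [c] counts the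
    ancestors that row [i] gains when it is raised. *)
Lemma psi_raise n b i : 0 < i < n ->
  let h := nxt b n (b i) i in
  exists2 c, 0 < c & forall l, l < n ->
    psi n (raise b i h) l = psi n b l + c * (i <= l < h).
Proof.
move=> Hi h; have [N1 N2 N3] := nxtP b (b i) (ltac:(lia) : i < n); rewrite -/h in N1 N2 N3.
set b' := raise b i h.
have b'_lo l : l < i -> b' l = b l by rewrite /b' /raise => li; lia.
have b'_mid l : i <= l < h -> b' l = b l + 1 by rewrite /b' /raise => ->.
have b'_hi l : h <= l -> b' l = b l by rewrite /b' /raise => hl; lia.
have bi_le l : i <= l < h -> b i <= b l.
  move=> Hl; have [->//|il] : l = i \/ i < l by lia.
  by apply: N2; lia.
pose s (x : nat -> nat) := \sum_(0 <= p < i) anc 0 x p i.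
have s_le : s b <= s b'.
  apply: leq_sum_nat => p Hp; case: (boolP (anc 0 b p i)) => // /ancP A.
  rewrite (introT (ancP _ _ _ _)) // => l Hl; rewrite b'_lo; last lia.
  by have := A l Hl; rewrite /b' /raise; lia.
have mid l : i <= l < h -> dep 0 b' l = s b' + \sum_(i <= p < l) anc 0 b p l /\
                          dep 0 b l = s b + \sum_(i <= p < l) anc 0 b p l.
  move=> Hl; rewrite !(@dep_split 0 _ i l) ?(proj1 (andP Hl)) //.
  split; congr (_ + _); apply: eq_big_nat => p Hp; congr nat_of_bool.
  - apply/ancP/ancP => A q Hq; first by apply: A; lia.
    case: (leqP q i) => qi; first by apply: A; lia.
    have := A i ltac:(lia); have := bi_le q ltac:(lia); have := b'_lo p ltac:(lia).
    have := b'_mid i ltac:(lia); have := b'_mid q ltac:(lia); lia.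
  - apply/ancP/ancP => A q Hq; have := A q Hq; have := b'_mid p ltac:(lia);
    have := b'_mid q ltac:(lia); lia.
  - apply/ancP/ancP => A q Hq; first by apply: A; lia.
    case: (leqP q i) => qi; first by apply: A; lia.
    have := A i ltac:(lia); have := bi_le q ltac:(lia); lia.
exists (1 + (s b' - s b)) => // l ln; rewrite /psi ln.
case: (ltnP l i) => li.
  rewrite b'_lo // (_ : _ && _ = false) ?muln0 ?addn0; last lia.
  by rewrite (@eq_dep 0 b' b) // => q ql; apply: b'_lo; lia.
case: (ltnP l h) => lh /=.
  have [-> ->] := mid l ltac:(lia); rewrite b'_mid; last lia.
  by rewrite muln1; lia.
rewrite muln0 addn0 b'_hi //; congr (_ + _).
apply: eq_big_nat => p Hp; congr nat_of_bool.
(* Row [h] is lower than [b i], so it blocks every raised row from being an ancestor of [l], and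
   ancestors left of [i] are too low to be affected. *)
have bh := N3 ltac:(lia).
case: (leqP h p) => hp.
  by apply/ancP/ancP => A q Hq; have := A q Hq; have := b'_hi p hp; have := b'_hi q ltac:(lia); lia.
case: (leqP i p) => ip.
  have bp := bi_le p ltac:(lia).
  have := b'_hi h (leqnn h); have := b'_mid p ltac:(lia) => Ep Eh.
  by apply/ancP/ancP => /(_ h ltac:(lia)); lia.
have Ep := b'_lo p ltac:(lia); have Eh := b'_hi h (leqnn h).
have Eq q : b' q = b q \/ b' q = b q + 1 /\ b i <= b q.
  case: (boolP (i <= q < h)) => Hq; last by left; rewrite /b' /raise (negbTE Hq) addn0.
  by right; rewrite b'_mid // bi_le.
by apply/ancP/ancP => A q Hq; have := A q Hq; have := A h ltac:(lia); have := Eq q; lia.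
Qed.

(** Thus a greedy step of [b] and a Tamari step of [psi n b] at [i] act on the same rows. *)
Lemma psi_nxt n b i : i < n ->
  nxt (psi n b) n (1 + psi n b i) i = nxt b n (0 + b i) i.
Proof.
move=> i_n; have [N1 N2 N3] := nxtP b (0 + b i) i_n.
set h := nxt b _ _ _ in N1 N2 N3 *; apply: nxt_unique => //.
  move=> l Hl; apply: psi_anc; first lia.
  by rewrite (@anc_nxt _ _ n) // -/h; lia.
move=> hn; have [|//|] := @psi_not_anc n b i h; rewrite ?hn ?andbT; try lia.
  by rewrite (@anc_nxt _ _ n) // -/h; lia.
by move=> _; rewrite -/h ltnS => /ltnW.
Qed.

(** On paths of maximal in-degree this inclusion turns out to be equivalent to the Tamari order. *)
Definition anc_incl (n : nat) (a a' : nat -> nat) : Prop :=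
  forall d j i, 0 < d -> j < i < n -> anc d a j i -> anc d a' j i.

(** A relation could break only by raising [j] but not some [q] in [(j, l]]. Then row [e], of height
    at most [a i <= a j], lies between, which [d > 0] forbids. *)
Lemma anc_incl_step k n a a' i : step 1 k n a a' i -> anc_incl n a a'.
Proof.
move=> [Hi lt_i Ea] d j l d_gt0 Hjl /ancP A.
have [N1 N2 N3] := nxtP a (1 + a i) (ltac:(lia) : i < n).
set e := nxt _ _ _ _ in Ea N1 N2 N3.
apply/ancP => q Hq; have Aq := A q Hq; rewrite !Ea /raise; try lia.
case: (boolP (i <= j < e)) => Hj; last by lia.
case: (ltnP q e) => qe; first by rewrite (_ : i <= q); lia.
have := A e ltac:(lia); have := N3 ltac:(lia).
have : a i <= a j by (have [->//|ij] : j = i \/ i < j by lia); have := N2 j ltac:(lia); lia.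
lia.
Qed.

(** Take for [q] the last row before [l] lower than [x l]. The relation is tight at [l], so it
    bounds row [l] from below in every vector to which it passes. *)
Lemma exists_anc x i l : i < l -> x i < x l ->
  exists q, [/\ i <= q < l, x q < x l & anc (x l - x q) x q l].
Proof.
move=> il lt_x; pose P q := (i <= q < l) && (x q < x l).
have exP : exists q, P q by exists i; rewrite /P leqnn il.
have ubP q : P q -> q <= l by rewrite /P; lia.
have [q Pq maxq] := ex_maxnP exP ubP; move: Pq => /andP[Hq xq].
exists q; split=> //; apply/ancP => r Hr; rewrite subnK ?(ltnW xq) //.
rewrite leqNgt; apply/negP => lt_r.
have rl : r < l by rewrite ltnNge; apply/negP => lr; move: lt_r; rewrite (_ : r = l); lia.
by have := maxq r; rewrite /P lt_r andbT; lia.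
Qed.

Lemma first_diff n (x y : nat -> nat) : ~ (forall l, l < n -> x l = y l) ->
  exists i, [/\ i < n, x i != y i & forall l, l < i -> x l = y l].
Proof.
move=> H; pose P i := (i < n) && (x i != y i).
case: (boolP [exists i : 'I_n, x i != y i]) => [/existsP[i Hi] | /existsPn N].
  have exP : exists i, P i by exists i; rewrite /P ltn_ord.
  have [j /andP[jn Hj] minj] := ex_minnP exP.
  exists j; split=> // l lj; apply/eqP/negPn/negP => nl.
  by have := minj l; rewrite /P nl (ltn_trans lj jn) => /(_ isT); lia.
case: H => l ln; apply/eqP; by have := N (Ordinal ln); rewrite negbK.
Qed.

(** This makes every Tamari step a cover. *)
Lemma step_squeeze k n lo z hi i : step 1 k n lo hi i ->
    anc_incl n lo z -> anc_incl n z hi ->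
    (forall l, l < n -> lo l <= z l <= hi l) ->
  (forall l, l < n -> z l = lo l) \/ (forall l, l < n -> z l = hi l).
Proof.
move=> [Hi lt_i Ea] I1 I2 bnd.
have [N1 N2 N3] := nxtP lo (1 + lo i) (ltac:(lia) : i < n).
set e := nxt _ _ _ _ in Ea N1 N2 N3.
have E1 l : l < n -> hi l = lo l + (i <= l < e) by move/ltnW/Ea.
have i_n : i < n by lia.
have [zi|zi] : z i = lo i \/ z i = hi i by have := bnd i i_n; rewrite E1 //; lia.
- left=> l0 l0n; apply: contraTeq isT => nz.
  have [|l [ln zl zeq]] := @first_diff n z lo; first by move=> H; rewrite H ?eqxx in nz.
  have Hl : i < l < e.
    have ne_li : l != i by apply: contraNneq zl => ->; rewrite zi.
    by have := bnd l ln; rewrite E1 //; lia.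
  have zl1 : z l = lo l + 1 by have := bnd l ln; rewrite E1 //; lia.
  (* At the first row [l] raised in [z], a tight relation with an unraised row [q] cannot pass to
     [hi], where both are raised. The other case is dual, with a relation passing from [lo] to
     [z]. *)
  have [|q [Hq zq A]] := @exists_anc z i l ltac:(lia); first by have := N2 l Hl; lia.
  have /ancP/(_ l ltac:(lia)) := I2 _ _ _ (ltac:(lia) : 0 < z l - z q) (ltac:(lia) : q < l < n) A.
  by rewrite !E1; try lia; have := zeq q ltac:(lia); lia.
- right=> l0 l0n; apply: contraTeq isT => nz.
  have [|l [ln zl zeq]] := @first_diff n z hi; first by move=> H; rewrite H ?eqxx in nz.
  have Hl : i < l < e.
    have ne_li : l != i by apply: contraNneq zl => ->; rewrite zi.
    by have := bnd l ln; move: zl; rewrite E1 //; lia.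
  have zl1 : z l = lo l by have := bnd l ln; move: zl; rewrite E1 //; lia.
  have [|q [Hq zq A]] := @exists_anc lo i l ltac:(lia); first by have := N2 l Hl; lia.
  have /ancP/(_ l ltac:(lia)) := I1 _ _ _ (ltac:(lia) : 0 < lo l - lo q) (ltac:(lia) : q < l < n) A.
  by have := zeq q ltac:(lia); rewrite E1; lia.
Qed.

(** The strict inequality ensures that row [e] still ends the excursion after the rows before it are
    lowered. *)
Lemma pred_step k n a i : hpath k n a -> 0 < i < n ->
    a (nxt a n (1 + a i) i) < a i ->
  let lo l := a l - (i <= l < nxt a n (1 + a i) i) in
  hpath k n lo /\ step 1 k n lo a i.
Proof.
move=> [a0 an aS] Hi lt_e.
have [N1 N2 N3] := nxtP a (1 + a i) (ltac:(lia) : i < n).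
set e := nxt _ _ _ _ in lt_e N1 N2 N3 *; move=> lo.
have lo_out l : ~~ (i <= l < e) -> lo l = a l by rewrite /lo => /negbTE ->; lia.
have lo_in l : i <= l < e -> lo l + 1 = a l.
  rewrite /lo => Hl; rewrite Hl subnK //.
  by (have [->|il] : l = i \/ i < l by lia); [|have := N2 l ltac:(lia)]; lia.
have E : nxt lo n (1 + lo i) i = e.
  apply: nxt_unique => // [l Hl|en].
    have := N2 l Hl; have := lo_in l ltac:(lia); have := lo_in i ltac:(lia); lia.
  by rewrite lo_out; [have := lo_in i ltac:(lia) | ]; lia.
have ei := aS i.-1 ltac:(lia); rewrite prednK in ei; last lia.
split.
  split; [by rewrite lo_out //; lia | by rewrite lo_out //; lia |].
  move=> j jn; have := aS j jn.
  (* Only at row [e] does the slope grow, and there [a e < a i <= a j]. *)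
  case: (j.+1 =P e) => [je|ne]; last by rewrite /lo; lia.
  have := lo_in j ltac:(lia); rewrite (lo_out j.+1); last lia.
  rewrite je.
  have : a i <= a j by (have [->//|ij] : j = i \/ i < j by lia); have := N2 j ltac:(lia); lia.
  lia.
split=> //.
  have := lo_in i ltac:(lia); rewrite (lo_out i.-1); lia.
move=> l ln; rewrite E /raise.
by case: (boolP (i <= l < e)) => Hl; [rewrite lo_in | rewrite lo_out ?addn0].
Qed.

Lemma step_pred k n lo a i : step 1 k n lo a i ->
  let e := nxt a n (1 + a i) i in
  [/\ (e < n -> a e < a i), 0 < a i & forall l, l <= n -> lo l = a l - (i <= l < e)].
Proof.
move=> [Hi lt_i Ea].
have [N1 N2 N3] := nxtP lo (1 + lo i) (ltac:(lia) : i < n).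
set e' := nxt lo _ _ _ in Ea N1 N2 N3.
have ai : a i = lo i + 1 by rewrite Ea /raise; lia.
have E : nxt a n (1 + a i) i = e'.
  apply: nxt_unique => // [l Hl|en].
    have := N2 l Hl; rewrite !Ea /raise; lia.
  have := N3 en; rewrite !Ea /raise; lia.
rewrite /= E; split; [|lia|].
  by move=> en; have := N3 en; rewrite !Ea /raise; lia.
by move=> l ln; rewrite Ea // /raise addnK.
Qed.

Lemma greedy_step_below k n b b' i : 0 < k ->
    hpath k.-1 n b -> hpath k.-1 n b' -> anc_incl n (psi n b) (psi n b') ->
    i < n -> b i != b' i -> (forall l, l < i -> b l = b' l) ->
  [/\ 0 < i, b i < b i.-1 + k.-1 &
      anc_incl n (psi n (raise b i (nxt b n (b i) i))) (psi n b')].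
Proof.
move=> k_gt0 Hb Hb' I i_n ne_i eq_lt.
have [b0 bn bS] := Hb; have [b'0 b'n b'S] := Hb'.
have i_gt0 : 0 < i by rewrite lt0n; apply: contraNneq ne_i => ->; rewrite b0 b'0.
have [a0 _ _] := hpath_psi Hb k_gt0 (ltac:(lia) : 0 < n).
have eq_psi_lt l : l < i -> psi n b l = psi n b' l.
  by move=> li; apply: eq_psi => q ql; apply: eq_lt; lia.
have lt_i : b i < b' i.
  case: (ltngtP (b i) (b' i)) ne_i => // lt_i _.
  (* Otherwise a tight relation of [psi n b] into row [i], starting at a row where both vectors
     agree, would force [psi n b i <= psi n b' i]. *)
  have lt_psi : psi n b' i < psi n b i by apply: psi_mono => // l /eq_lt.
  have [|q [Hq xq A]] := @exists_anc (psi n b) 0 i i_gt0; first by rewrite a0; lia.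
  have /ancP/(_ i ltac:(lia)) := I _ _ _ (ltac:(lia) : 0 < psi n b i - psi n b q) (ltac:(lia) : q < i < n) A.
  by rewrite -eq_psi_lt; lia.
have i1 : i.-1.+1 = i by rewrite prednK.
split=> //.
  by have := b'S i.-1 ltac:(lia); rewrite i1 (eq_lt i.-1); lia.
have Hi : 0 < i < n by rewrite i_gt0.
have [c c_gt0] := psi_raise b Hi.
have Eh := psi_nxt b i_n; rewrite add0n in Eh.
have [N1 N2 N3] := nxtP (psi n b) (1 + psi n b i) i_n.
rewrite Eh in N1 N2 N3; set h := nxt b n (b i) i in N1 N2 N3 Eh *.
set b1 := raise b i h; move=> Ec.
have le_i : psi n b1 i <= psi n b' i.
  have b1_lo l : l < i -> b1 l = b l by move=> li; rewrite /b1 /raise; lia.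
  have b1_i : b1 i = b i + 1 by rewrite /b1 /raise; lia.
  case: (ltngtP (b1 i) (b' i)) => C; [|lia|].
    by apply/ltnW/psi_mono => // l li; rewrite b1_lo // eq_lt.
  rewrite (@eq_psi n b1 b') // => l; rewrite leq_eqVlt => /orP[/eqP -> //|li].
  by rewrite b1_lo // eq_lt.
move: (psi n b) (psi n b') (psi n b1) I eq_psi_lt N2 N3 Ec le_i => a a' a1 I eq_a N2 N3 Ec le_i.
have ge_i l : i <= l < h -> a i <= a l.
  by move=> Hl; (have [->//|il] : l = i \/ i < l by lia); have := N2 l ltac:(lia); lia.
have out l : l < n -> ~~ (i <= l < h) -> a1 l = a l.
  by move=> ln /negbTE out; rewrite Ec // out muln0 addn0.
have mid l : i <= l < h -> a1 l = a l + c.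
  by move=> Hl; rewrite Ec ?Hl ?muln1 //; lia.
move=> d q l d_gt0 Hql /ancP A.
case: (leqP h q) => hq.
  apply: I => //; apply/ancP => r Hr; have := A r Hr; rewrite !out; lia.
case: (leqP i q) => iq.
  have E1 := mid q ltac:(lia).
  case: (ltnP l h) => lh.
    by apply: I => //; apply/ancP => r Hr; have := A r Hr; rewrite !mid; lia.
  have := A h ltac:(lia); rewrite (out h); [|lia|lia].
  have := N3 ltac:(lia); have := ge_i q ltac:(lia); lia.
have E1 := out q ltac:(lia) ltac:(lia).
case: (ltnP l i) => li.
  by apply: I => //; apply/ancP => r Hr; have := A r Hr; rewrite !out; lia.
case: (leqP h l) => lh.
  apply: I => //; apply/ancP => r Hr; have Ar := A r Hr.
  case: (boolP (i <= r < h)) => Hr'; last by move: Ar; rewrite !out; lia.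
  have := A h ltac:(lia); rewrite (out h); [|lia|lia].
  have := N3 ltac:(lia); have := ge_i r Hr'; lia.
(* Only these relations, from [q < i] into a raised row [l], can be new. At row [i] they hold in
   [a'] by [le_i]; later rows are above row [i] in [a], hence also in [a']. *)
apply/ancP => r Hr; rewrite -eq_a //; have Ar := A r Hr.
case: (ltngtP r i) => ri.
- by rewrite -eq_a //; move: Ar; rewrite !out; lia.
- have A1 : anc 1 a i r by apply/ancP => t Ht; apply: N2; lia.
  have /ancP/(_ r ltac:(lia)) := I 1 i r isT ltac:(lia) A1.
  have := A i ltac:(lia); lia.
by move: Ar; rewrite ri; lia.
Qed.

(** * The two orders on Dyck paths *)

Lemma connect_ind_trans (T : finType) (e : rel T) (R : T -> T -> Prop) :
    (forall x, R x x) -> (forall x y z, R x y -> R y z -> R x z) ->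
    (forall x y, e x y -> R x y) ->
  forall x y, connect e x y -> R x y.
Proof.
move=> Rxx Rtr Re x y /connectP[p]; elim: p x => [|z p IH] x /= => [_ ->|] //.
by case/andP=> /Re Rxz pth E; apply: Rtr Rxz (IH z pth E).
Qed.

Lemma eq_nxt a a' n v j : (forall l, l < n -> a l = a' l) -> nxt a n v j = nxt a' n v j.
Proof.
move=> E; rewrite /nxt; congr (_ + _); apply: eq_in_find => l.
by rewrite mem_iota => Hl; rewrite E //; lia.
Qed.

Lemma eq_anc_incl n a a1 a' a1' :
    (forall l, l < n -> a l = a1 l) -> (forall l, l < n -> a' l = a1' l) ->
  anc_incl n a a' -> anc_incl n a1 a1'.
Proof.
move=> E E' I d j i d_gt0 Hji A.
rewrite -(@eq_anc d a') => [||l li]; [|lia|by apply: E'; lia].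
by apply: I => //; rewrite (@eq_anc d _ a1) => [||l li] //; [lia|apply: E; lia].
Qed.

Section Tamari.
Variables (m n : nat).
Implicit Types D : dyck n m.

Lemma tamari_le_raise D D' i c : 0 < i < n ->
    (forall l, l < n ->
      ht D' l = ht D l + c * (i <= l < nxt (ht D) n (1 + ht D i) i)) ->
  tamari_le D D'.
Proof.
move=> Hi; have i_n : i < n by lia.
elim: c D => [|c IH] D E.
  have -> : D = D' by apply: ht_inj => l ln; rewrite E // mul0n addn0.
  exact: connect0.
have [N1 N2 N3] := nxtP (ht D) (1 + ht D i) i_n.
set h := nxt _ _ _ _ in E N1 N2 N3.
(* The step is possible because the target [D'], with row [i] raised even further, is a path. *)
have lt_i : ht D i < ht D i.-1 + m.
  have [_ _ /(_ i.-1 ltac:(lia))] := hpath_ht D'.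
  rewrite prednK; last lia.
  rewrite !E; [|lia|lia].
  rewrite (_ : i <= i < h = true) ?muln1; last lia.
  by rewrite (_ : i <= i.-1 < h = false) ?muln0; lia.
have [D1 E1] := exists_ht (hpath_raise (hpath_ht D) (ltac:(lia) : 0 < i < h) ltac:(lia) lt_i).
apply: (@connect_trans _ _ D1).
  by apply/connect1/tamari_stepP; exists i.
have Eh : nxt (ht D1) n (1 + ht D1 i) i = h.
  apply: nxt_unique => // [l Hl|hn].
    by have := N2 l Hl; rewrite !E1 /raise; lia.
  by have := N3 hn; rewrite !E1 /raise; lia.
apply: IH => l ln; rewrite Eh E // E1 ?(ltnW ln) // /raise mulSn; lia.
Qed.

Lemma tamari_le_incl D D' : tamari_le D D' ->
  anc_incl n (ht D) (ht D') /\ forall l, l <= n -> ht D l <= ht D' l.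
Proof.
move: D D'; apply: connect_ind_trans => [D|D1 D2 D3 [I1 L1] [I2 L2]|D D' /tamari_stepP[i S]].
- by split=> // d j i _ _.
- split; first by move=> d j i d_gt0 Hji /(I1 _ _ _ d_gt0 Hji); apply: I2.
  by move=> l ln; apply: leq_trans (L1 l ln) (L2 l ln).
split; first exact: anc_incl_step S.
by case: S => _ _ E l ln; rewrite E // leq_addr.
Qed.

Lemma tamari_step_neq D D' : tamari_step D D' -> D != D'.
Proof.
case/tamari_stepP=> i [Hi _ E]; apply/eqP => ED; have := E i ltac:(lia).
have [N1 _ _] := nxtP (ht D) (1 + ht D i) (ltac:(lia) : i < n).
by rewrite -ED /raise; lia.
Qed.

Lemma covered_by_tamari D D' : covered_by (@tamari_le n m) D' D = tamari_step D' D.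
Proof.
apply/idP/idP => [/and3P[ne le /forallP cov]|S].
  have /connectP[[|z p] /=] := le; first by move=> _ E; rewrite E eqxx in ne.
  case/andP=> S pth E; have := cov z.
  rewrite {1}/tamari_le connect1 //= (_ : tamari_le z D); last by apply/connectP; exists p.
  have := tamari_step_neq S; rewrite eq_sym => /negbTE -> /= /eqP E'.
  by rewrite -E'.
apply/and3P; split; [exact: tamari_step_neq | exact: connect1 |].
apply/forallP => z; apply/implyP => /andP[/tamari_le_incl[I1 L1] /tamari_le_incl[I2 L2]].
have /tamari_stepP[i Si] := S.
have [|H|H] := step_squeeze Si I1 I2.
- by move=> l ln; rewrite L1 ?L2 // ltnW.
- by apply/orP; left; apply/eqP/ht_inj.
by apply/orP; right; apply/eqP/ht_inj.
Qed.

(* The rows whose excursion is followed by an east step, i.e. those that index the covers below [D]. *)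
Definition drops D : {set 'I_n} :=
  [set i : 'I_n | (0 < i) && (ht D (nxt (ht D) n (1 + ht D i) i) < ht D i)].

(** [pred_step] provides a lower cover for each index, and [step_pred] shows that there is no
    other. *)
Lemma indegreeE D : indegree D = #|drops D|.
Proof.
have [f Hf] : exists f : 'I_n -> dyck n m,
    forall i, i \in drops D -> step 1 m n (ht (f i)) (ht D) i.
  apply: (@fin_all_exists _ (fun=> dyck n m) (fun i D' => i \in drops D -> step 1 m n (ht D') (ht D) i)).
  move=> i; case: (boolP (i \in drops D)) => [|_]; last by exists D.
  rewrite inE => /andP[i_gt0 lt_e].
  have Hi : 0 < i < n by rewrite i_gt0 ltn_ord.
  have [/= Hlo [S1 S2 S3]] := pred_step (hpath_ht D) Hi lt_e.
  have [D' E] := exists_ht Hlo; exists D' => _.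
  split=> //; first by rewrite !E; lia.
  move=> l ln; rewrite S3 // /raise E // E; last lia.
  by congr (_ + (_ && (_ < _))); apply: eq_nxt => q qn; rewrite E // ltnW.
rewrite /indegree; have -> : [set D' | covered_by (@tamari_le n m) D' D] = f @: drops D.
  apply/setP => D'; rewrite inE covered_by_tamari; apply/tamari_stepP/imsetP.
    move=> [i S]; have [Hi _ _] := S; have [e_lt a_gt0 E] := step_pred S.
    have i_n : i < n by lia.
    have Hd : Ordinal i_n \in drops D.
      rewrite inE /=; apply/andP; split; first lia.
      have [N1 _ _] := nxtP (ht D) (1 + ht D i) i_n.
      have [_ Dn _] := hpath_ht D.
      by case: ltngtP e_lt N1 => [_ ->|//|->] //; [lia | rewrite Dn].
    exists (Ordinal i_n) => //; apply: ht_inj => l ln.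
    have [_ _ E'] := step_pred (Hf _ Hd).
    by rewrite E ?E' // ltnW.
  by case=> i Hi ->; exists i; apply: Hf.
(* The index is recovered as the first row that was lowered. *)
apply: card_in_imset => i j Hi Hj E.
have [_ ai Ei] := step_pred (Hf i Hi); have [_ aj Ej] := step_pred (Hf j Hj).
rewrite -E in Ej.
have [Ni _ _] := nxtP (ht D) (1 + ht D i) (ltn_ord i).
have [Nj _ _] := nxtP (ht D) (1 + ht D j) (ltn_ord j).
have := Ei i (ltnW (ltn_ord i)); have := Ej j (ltnW (ltn_ord j)).
rewrite (Ei j) ?(Ej i) ?(ltnW (ltn_ord _)) // => E1 E2.
by apply: val_inj => /=; lia.
Qed.

Lemma exists_primitive : 0 < m -> exists T : dyck n m, primitive n (ht T).
Proof.
move=> m_gt0.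
(* All north steps of [T] come first, so its heights increase strictly until the final point. *)
have [T ET] : exists T : dyck n m, forall l, l <= n -> ht T l = if l < n then m * l else 0.
apply: exists_ht; split; [by rewrite muln0 if_same | by rewrite ltnn |].
move=> i i_n; rewrite i_n; case: ifP => // _; by rewrite mulnS addnC.
exists T.
move=> i Hi; have i_n : i < n by lia.
have [N1 _ N3] := nxtP (ht T) (ht T i).+1 i_n.
set e := nxt _ _ _ _ in N1 N3 *.
have Ei : ht T i = m * i by rewrite ET ?(ltnW i_n) // i_n.
case: (ltngtP e n) => en; [|lia|].
  have := N3 en; rewrite ET ?(ltnW en) // en Ei ltnS leq_mul2l; lia.
by rewrite Ei ET en // ltnn muln_gt0; lia.
Qed.

(** Every [drops] lies in the set of positive rows, and the path of [exists_primitive] attains this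
    bound. *)
Lemma dyck_inP D : 0 < m -> reflect (primitive n (ht D)) (D \in dyck_in n m).
Proof.
move=> m_gt0; pose pos := [set i : 'I_n | 0 < i].
have sub D1 : drops D1 \subset pos by apply/subsetP => i; rewrite !inE => /andP[].
have drops_eq D1 : reflect (primitive n (ht D1)) (drops D1 == pos).
  apply: (iffP eqP) => [E i /andP[i_gt0 i_n]|P1].
    have : Ordinal i_n \in drops D1 by rewrite E inE.
    by rewrite inE => /andP[_].
  apply/setP => i; rewrite !inE; case: posnP => //= i_gt0.
  by apply: P1; rewrite i_gt0 ltn_ord.
rewrite inE; apply: (iffP forallP) => [max|PD D'].
  have [T PT] := exists_primitive m_gt0.
  apply/drops_eq; rewrite eqEcard sub -indegreeE.
  by have := max T; rewrite [indegree T]indegreeE (eqP (introT (drops_eq T) PT)).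
rewrite !indegreeE (eqP (introT (drops_eq D) PD)).
exact: subset_leq_card.
Qed.

Lemma card_hpos_before D (i : 'I_n) : primitive n (ht D) ->
  #|[set j : 'I_n | comes_before D (hpos D j) (rpos D i)]| + dep 1 (ht D) i = i.
Proof.
move=> PD; have i_n := ltn_ord i.
(* By primitivity the first later row of height at most [ht D j] is already lower, so [d = 0] and
   [d = 1] give the same ancestors. *)
have E j : j < n -> (nxt (ht D) n (ht D j) j <= i) = (j < i) && ~~ anc 1 (ht D) j i.
  move=> jn; have [N1 _ _] := nxtP (ht D) (ht D j) jn.
  case: (ltnP j i) => ji /=; last by lia.
  rewrite leqNgt -(@anc_nxt 0) //; congr negb; apply/idP/idP => [/ancP A|/ancP A].
    apply: contraT => nA.
    have [/= H1 H2 _] := phi_not_anc (hpath_ht D) PD (ltac:(lia) : j < i < n) nA.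
    by have := A _ H1; lia.
  by apply/ancP => l /A; lia.
rewrite -sum1_card big_mkcond /= (eq_bigr (fun j : 'I_n => ((j < i) && ~~ anc 1 (ht D) j i : nat))).
  rewrite -(big_mkord xpredT (fun j => ((j < i) && ~~ anc 1 (ht D) j i : nat))).
  rewrite (@big_cat_nat _ _ _ i 0 n) ?(ltnW i_n) //=.
  have -> : \sum_(i <= j < n) ((j < i) && ~~ anc 1 (ht D) j i : nat) = 0.
    rewrite big_nat big1 // => j /andP[ij _].
    by rewrite ltnNge ij.
  rewrite addn0 /dep -big_split /= (eq_big_nat _ _ (F2 := fun=> 1)).
    by rewrite sum_nat_const_nat muln1 subn0.
  by move=> j /= Hj; rewrite Hj; case: anc.
by move=> j _; rewrite inE comes_before_hpos E //; case: (_ && _).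
Qed.

Lemma LAhatE D (i : 'I_n) : 0 < m -> primitive n (ht D) ->
  LAhat D i = Posz (m.-1 * i - phi (ht D) i).
Proof.
move=> m_gt0 PD; have i_n := ltnW (ltn_ord i).
(* Realizing [phi (ht D)] by a path gives [phi (ht D) i <= m.-1 * i], so the subtraction is
   exact. *)
have [D' E] := exists_ht (hpath_phi (hpath_ht D) PD m_gt0).
have := ht_le D' i_n; rewrite E //.
have := card_hpos_before i PD; have := dep_le (ht D) i; have := north_x_ht D i_n.
have : m * i = m.-1 * i + i by rewrite -{1}(prednK m_gt0) mulSn addnC.
rewrite /LAhat LAE /phi; set s := #|_|; lia.
Qed.

End Tamari.

Lemma greedy_le_incl m n (D D' : dyck n m.-1) : 0 < m ->
  anc_incl n (psi n (ht D)) (psi n (ht D')) -> greedy_le D D'.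
Proof.
move=> m_gt0.
(* The measure is the sum of the x-coordinates of all [r_l]; each greedy step lowers it. *)
have [N] := ubnP (\sum_(0 <= l < n) (m.-1 * l - ht D l)).
elim: N D => // N IH D lt_N I.
case: (boolP [forall i : 'I_n, ht D i == ht D' i]) => [/forallP E | /forallPn[i0 ne_i0]].
  have -> : D = D' by apply: ht_inj => l ln; apply/eqP/(E (Ordinal ln)).
  exact: connect0.
have [|i [i_n ne_i eq_lt]] := @first_diff n (ht D) (ht D').
  by move=> E; rewrite E // eqxx in ne_i0.
have [i_gt0 lt_i I1] := greedy_step_below m_gt0 (hpath_ht D) (hpath_ht D') I i_n ne_i eq_lt.
have [N1 _ _] := nxtP (ht D) (ht D i) i_n.
set h := nxt _ _ _ _ in N1 I1.
have [D1 E1] := exists_ht (hpath_raise (hpath_ht D) (ltac:(lia) : 0 < i < h) ltac:(lia) lt_i).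
apply: (@connect_trans _ _ D1).
  by apply/connect1/greedy_stepP; exists i; split=> //; rewrite i_gt0.
apply: IH; last first.
  apply: eq_anc_incl I1 => // l ln; apply: eq_psi => q ql; rewrite E1 //; lia.
rewrite -ltnS; apply: leq_ltn_trans lt_N.
rewrite !(@big_cat_nat _ _ _ i 0 n) ?(ltnW i_n) //=.
rewrite -addnS leq_add //.
  by apply: leq_sum_nat => l Hl; rewrite E1 /raise; lia.
rewrite !(big_ltn i_n) -addSn leq_add //.
  have := @ht_le _ _ D1 i (ltnW i_n); rewrite E1 /raise; lia.
by apply: leq_sum_nat => l Hl; rewrite E1 /raise; lia.
Qed.

Theorem mainTheorem12 (m n : nat) (m_ge1 : 1 <= m) (n_ge1 : 1 <= n) :
  exists phi : {D : dyck n m | D \in dyck_in n m} -> dyck n m.-1,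
    (forall D (i : 'I_n), Posz (LA (phi D) i) = LAhat (val D) i) /\
    poset_iso (fun D D' => tamari_le (val D) (val D')) (@greedy_le n m.-1) phi.
Proof.
pose S := {D : dyck n m | D \in dyck_in n m}.
have prim (D : S) : primitive n (ht (val D)) by apply/dyck_inP => //; apply: (valP D).
have [f Ef] : exists f : S -> dyck n m.-1,
    forall D l, l <= n -> ht (f D) l = phi (ht (val D)) l.
  apply: (@fin_all_exists _ (fun=> dyck n m.-1)
    (fun D D' => forall l, l <= n -> ht D' l = phi (ht (val D)) l)) => D.
  exact: exists_ht (hpath_phi (hpath_ht _) (prim D) m_ge1).
have [g Eg] : exists g : dyck n m.-1 -> S,
    forall D l, l <= n -> ht (val (g D)) l = psi n (ht D) l.
  apply: (@fin_all_exists _ (fun=> S)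
    (fun D D' => forall l, l <= n -> ht (val D') l = psi n (ht D) l)) => D.
  have [D' E] := exists_ht (hpath_psi (hpath_ht D) m_ge1 n_ge1).
  have D'_in : D' \in dyck_in n m.
    apply/dyck_inP => // i Hi.
    have := primitive_psi (hpath_ht D) Hi.
    have [N1 _ _] := nxtP (psi n (ht D)) (psi n (ht D) i).+1 (ltac:(lia) : i < n).
    rewrite (@eq_nxt (ht D') (psi n (ht D))) => [|l ln]; last by rewrite E // ltnW.
    by rewrite !E //; lia.
  by exists (exist _ D' D'_in).
have fK : cancel f g.
  move=> D; apply/val_inj/ht_inj => l ln; rewrite Eg ?(ltnW ln) //.
  rewrite (@eq_psi n _ (phi (ht (val D)))) => [|q ql]; last by rewrite Ef //; lia.
  exact: psi_phi (hpath_ht _) (prim D) ln.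
have gK : cancel g f.
  move=> D; apply/ht_inj => l ln; rewrite Ef ?(ltnW ln) // -[RHS](@phi_psi n (ht D)) //.
  by rewrite /phi (@eq_dep _ _ (psi n (ht D))) => [|q ql]; rewrite Eg //; lia.
exists f; split=> [D i|].
  rewrite (LAhatE _ m_ge1 (prim D)) LAE -Ef ?(ltnW (ltn_ord i)) //; congr Posz.
  by have := @north_x_ht _ _ (f D) i (ltnW (ltn_ord i)); lia.
split; first by exists g.
move=> D D'; apply/idP/idP => [/tamari_le_incl[I _]|].
  apply: greedy_le_incl => //; apply: eq_anc_incl I => l ln.
    by rewrite -Eg ?fK // ltnW.
  by rewrite -Eg ?fK // ltnW.
(* It remains to see that [g] is monotone, which is checked on single greedy steps. *)
rewrite -{2}(fK D) -{2}(fK D'); move: (f D) (f D') => {D D'}.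
apply: connect_ind_trans => [D|D1 D2 D3|D D' /greedy_stepP[i [Hi lt_i E]]].
- exact: connect0.
- exact: connect_trans.
have [c _ Ec] := psi_raise (ht D) Hi.
apply: (@tamari_le_raise _ _ _ _ i c) => // l ln.
rewrite (@eq_nxt _ (psi n (ht D))) => [|q qn]; last by rewrite Eg // ltnW.
rewrite !Eg; try lia.
rewrite psi_nxt; last lia.
by rewrite -Ec //; apply: eq_psi => q ql; rewrite E //; lia.
Qed.
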